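(* Let $f\colon\mathcal E\to\mathcal B$ be an outer fibration of $\infty$-bicategories and $K\subseteq L$ an inclusion of scaled simplicial sets. Consider a lifting problem consisting of a commutative square with top map $$\alpha\colon(\Delta^{\{1\}}\otimes L)\coprod_{\Delta^{\{1\}}\otimes K}(\Delta^1_\flat\otimes K)\to\mathcal E,$$ bottom map $H\colon\Delta^1_\flat\otimes L\to\mathcal B$, left map the inclusion and right map $f$, such that $\alpha$ sends every edge of the form $\Delta^1\times\{v\}$ (for $v\in K$ a vertex) to an $f$-cartesian edge. Suppose that for every $u\in L_0\setminus K_0$ there exists an $f$-cartesian edge with target $\alpha(\Delta^{\{1\}}\times\{u\})$ which lifts $H(\Delta^1\times\{u\})$. Then there exists a lift $\widetilde H\colon\Delta^1_\flat\otimes L\to\mathcal E$. Furthermore, $\widetilde H$ can be chosen so that the edges $\widetilde H(\Delta^1\times\{u\})$ for $u\in L_0\setminus K_0$ are any prescribed collection of such $f$-cartesian lifts.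
   Context: A scaled simplicial set is a pair $(X,T_X)$ of a simplicial set and a set $T_X$ of 2-simplices (thin triangles) containing the degenerate ones; maps preserve thin triangles. $X_\flat$: only degenerate triangles thin. $(X,T)$ means: thin triangles are those of $T$ and the degenerate ones; $T_{|L}$ is the set of triangles of $L\subseteq X$ lying in $T$. An $\infty$-bicategory is a scaled simplicial set with the extension property against: (i) $(\Lambda^n_i,\{\Delta^{\{i-1,i,i+1\}}\}_{|\Lambda^n_i})\to(\Delta^n,\{\Delta^{\{i-1,i,i+1\}}\})$, $0<i<n$; (ii) $(\Delta^4,T)\to(\Delta^4,T\cup\{\Delta^{\{0,3,4\}},\Delta^{\{0,1,4\}}\})$, $T=\{\Delta^{\{0,2,4\}},\Delta^{\{1,2,3\}},\Delta^{\{0,1,3\}},\Delta^{\{1,3,4\}},\Delta^{\{0,1,2\}}\}$; (iii) $(\Lambda^n_0\coprod_{\Delta^{\{0,1\}}}\Delta^0,\{\Delta^{\{0,1,n\}}\})\to(\Delta^n\coprod_{\Delta^{\{0,1\}}}\Delta^0,\{\Delta^{\{0,1,n\}}\})$, $n\ge3$. A weak fibration is a map of scaled simplicial sets with the right lifting property against the maps (i) and against $(\Lambda^n_0\coprod_{\Delta^{\{0,1\}}}\Delta^0,\{\Delta^{\{0,1,n\}}\}_{|\Lambda^n_0})\subseteq(\Delta^n\coprod_{\Delta^{\{0,1\}}}\Delta^0,\{\Delta^{\{0,1,n\}}\})$ and $(\Lambda^n_n\coprod_{\Delta^{\{n-1,n\}}}\Delta^0,\{\Delta^{\{0,n-1,n\}}\}_{|\Lambda^n_n})\subseteq(\Delta^n\coprod_{\Delta^{\{n-1,n\}}}\Delta^0,\{\Delta^{\{0,n-1,n\}}\})$,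 $n\ge2$. It is an outer fibration if it detects thin triangles (a triangle is thin iff its image is) and its underlying map has the right lifting property against $\Lambda^n_0\coprod_{\Delta^{\{0,1\}}}\Delta^0\subseteq\Delta^n\coprod_{\Delta^{\{0,1\}}}\Delta^0$ and $\Lambda^n_n\coprod_{\Delta^{\{n-1,n\}}}\Delta^0\subseteq\Delta^n\coprod_{\Delta^{\{n-1,n\}}}\Delta^0$, $n\ge2$. An edge $e$ is $f$-cartesian if every square from $(\Lambda^n_n,\{\Delta^{\{0,n-1,n\}}\}_{|\Lambda^n_n})\subseteq(\Delta^n,\{\Delta^{\{0,n-1,n\}}\})$, $n\ge2$, to $f$ whose top map sends $\Delta^{\{n-1,n\}}$ to $e$ has a lift. The Gray product $(X,T_X)\otimes(Y,T_Y)$ of scaled simplicial sets is the scaled simplicial set with underlying simplicial set $X\times Y$, in which a triangle $(\sigma_X,\sigma_Y)$ is thin iff $\sigma_X\in T_X$, $\sigma_Y\in T_Y$ and either $\sigma_X$ degenerates along $\Delta^{\{1,2\}}$ or $\sigma_Y$ degenerates along $\Delta^{\{0,1\}}$; here $\sigma$ degenerates along $\Delta^{\{i,i+1\}}$ if $\sigma$ is degenerate and $\sigma_{|\Delta^{\{i,i+1\}}}$ is degenerate. *)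

(* Defs.v *)
From HB Require Import structures.
From Stdlib Require Import Relation_Operators.
From mathcomp Require Import all_boot boolp.

Set Implicit Arguments.
Unset Strict Implicit.
Unset Printing Implicit Defensive.

Local Open Scope quotient_scope.

(* Monotone maps [m] -> [n], where [n] = {0 < ... < n} is 'I_n.+1. *)
Record omap (m n : nat) := OMap {
  omap_fun :> {ffun 'I_m.+1 -> 'I_n.+1};
  omap_mono : [forall i : 'I_m.+1, forall j : 'I_m.+1, (i <= j) ==> (omap_fun i <= omap_fun j)] }.

HB.instance Definition _ m n := [isSub for @omap_fun m n].

Lemma omapP m n (a b : omap m n) : (forall i, a i = b i) -> a = b.
Proof. by move=> eq_ab; apply/val_inj/ffunP. Qed.

Lemma omap_leq m n (a : omap m n) (i j : 'I_m.+1) : i <= j -> a i <= a j.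
Proof. by move=> le_ij; have /forallP/(_ i)/forallP/(_ j)/implyP := omap_mono a; apply. Qed.

Lemma omk_subproof m n (f : 'I_m.+1 -> 'I_n.+1) :
  (forall i j : 'I_m.+1, i <= j -> f i <= f j) ->
  [forall i : 'I_m.+1, forall j : 'I_m.+1, (i <= j) ==> (finfun f i <= finfun f j)].
Proof.
by move=> Hf; apply/forallP=> i; apply/forallP=> j; apply/implyP=> /Hf; rewrite !ffunE.
Qed.

Definition omk m n (f : 'I_m.+1 -> 'I_n.+1)
  (Hf : forall i j : 'I_m.+1, i <= j -> f i <= f j) : omap m n := OMap (omk_subproof Hf).

Lemma omkE m n f Hf i : @omk m n f Hf i = f i.
Proof. by rewrite /omk /= ffunE. Qed.

Definition oid n : omap n n := @omk n n id (fun i j le_ij => le_ij).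

Definition ocomp l m n (b : omap m n) (a : omap l m) : omap l n :=
  @omk l n (fun i => b (a i)) (fun i j le_ij => omap_leq b (omap_leq a le_ij)).

Definition oconst m n (k : 'I_n.+1) : omap m n :=
  @omk m n (fun=> k) (fun _ _ _ => leqnn k).

Lemma codeg_subproof n (i : 'I_n.+1) (j : 'I_n.+2) : unbump i j < n.+1.
Proof.
rewrite /unbump; case: (ltnP i j) => [lt_ij|le_ji].
  by rewrite subn1 prednK ?(leq_trans _ lt_ij) // -ltnS ltn_ord.
by rewrite subn0 (leq_ltn_trans le_ji).
Qed.

Lemma codeg_mono n (i : 'I_n.+1) (j k : 'I_n.+2) :
  j <= k -> Ordinal (codeg_subproof i j) <= Ordinal (codeg_subproof i k).
Proof.
rewrite /= /unbump => le_jk; case: (ltnP i j) => [lt_ij|le_ji].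
  by rewrite (leq_trans lt_ij le_jk) leq_sub2r.
rewrite subn0; case: (ltnP i k) => [lt_ik|_]; last by rewrite subn0.
by rewrite subn1 -ltnS prednK ?(leq_trans _ lt_ik) // (leq_ltn_trans le_ji).
Qed.

(* The codegeneracy s^i : [n+1] -> [n] taking the value i twice. *)
Definition codeg n (i : 'I_n.+1) : omap n.+1 n := omk (@codeg_mono n i).

Lemma oseg_subproof n (i : 'I_n.+1) (j : 'I_2) : i + j < n.+2.
Proof. by case: i j => i Hi [j Hj] /=; rewrite ltnS -(addn1 n) leq_add // -ltnS. Qed.

(* [1] -> [n+1] with image {i, i+1}: restricting a simplex x along it gives
   x_{|Delta^{i,i+1}}. *)
Definition oseg n (i : 'I_n.+1) : omap 1 n.+1 :=
  @omk 1 n.+1 (fun j => Ordinal (oseg_subproof i j))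
    (fun j k le_jk => eq_ind_r is_true le_jk (leq_add2l i j k)).

Record sSet := SSet {
  cell :> nat -> Type;
  act : forall m n, omap m n -> cell n -> cell m;
  act_id : forall n (x : cell n), act (oid n) x = x;
  act_comp : forall l m n (a : omap l m) (b : omap m n) (x : cell n),
    act (ocomp b a) x = act a (act b x) }.
Arguments act {s m n} a x.

Record smap (X Y : sSet) := SMap {
  smap_fun :> forall n, X n -> Y n;
  smap_act : forall m n (a : omap m n) (x : X n),
    smap_fun (act a x) = act a (smap_fun x) }.

Definition smap_eq (X Y : sSet) (f g : smap X Y) : Prop := forall n (x : X n), f n x = g n x.

Definition smap_id (X : sSet) : smap X X := @SMap X X (fun n x => x) (fun m n a x => erefl).

Lemma smap_comp_subproof (X Y Z : sSet) (g : smap Y Z) (f : smap X Y) m n (a : omap m n) (x : X n) :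
  g m (f m (act a x)) = act a (g n (f n x)).
Proof. by rewrite !smap_act. Qed.

Definition smap_comp (X Y Z : sSet) (g : smap Y Z) (f : smap X Y) : smap X Z :=
  SMap (smap_comp_subproof g f).

Definition degenerate (X : sSet) n (x : X n.+1) : Prop :=
  exists (i : 'I_n.+1) (y : X n), x = act (codeg i) y.

Definition degenerate_along (X : sSet) n (i : 'I_n.+1) (x : X n.+1) : Prop :=
  degenerate x /\ degenerate (act (oseg i) x).

Lemma degenerate_smap (X Y : sSet) (f : smap X Y) n (x : X n.+1) :
  degenerate x -> degenerate (f _ x).
Proof. by case=> i [y ->]; exists i, (f _ y); rewrite smap_act. Qed.

Lemma degenerate_along_smap (X Y : sSet) (f : smap X Y) n (i : 'I_n.+1) (x : X n.+1) :
  degenerate_along i x -> degenerate_along i (f _ x).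
Proof. by case=> Dx Dix; split; rewrite -?smap_act; apply: degenerate_smap. Qed.

Definition target (X : sSet) (e : X 1) : X 0 := act (oconst 0 (ord_max : 'I_2)) e.

Lemma Delta_id k n (t : omap n k) : ocomp t (oid n) = t.
Proof. by apply: omapP => i; rewrite !omkE. Qed.

Lemma Delta_comp k l m n (a : omap l m) (b : omap m n) (t : omap n k) :
  ocomp t (ocomp b a) = ocomp (ocomp t b) a.
Proof. by apply: omapP => i; rewrite !omkE. Qed.

Definition Delta (k : nat) : sSet :=
  @SSet (fun n => omap n k) (fun m n a t => ocomp t a) (@Delta_id k) (@Delta_comp k).

(* The vertices of a simplex of Delta^k, in order: the simplex
   Delta^{a,b,c} of Delta^k is the one with vertex list [:: a; b; c]. *)
Definition vertices k n (t : Delta k n) : seq nat := [seq val (t i) | i <- enum 'I_n.+1].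

Record subc (X : sSet) := Subc {
  subc_mem :> forall n, X n -> bool;
  subc_act : forall m n (a : omap m n) (x : X n), subc_mem x -> subc_mem (act a x) }.

Section SubComplex.
Variables (X : sSet) (A : subc X).

Definition sub_cell n := {x : X n | A n x}.
Definition sub_act m n (a : omap m n) (x : sub_cell n) : sub_cell m :=
  exist (fun y => A m y) (act a (sval x)) (subc_act a (svalP x)).
Lemma sub_act_id n (x : sub_cell n) : sub_act (oid n) x = x.
Proof. by case: x => x Ax; apply: eq_exist; apply: act_id. Qed.
Lemma sub_act_comp l m n (a : omap l m) (b : omap m n) (x : sub_cell n) :
  sub_act (ocomp b a) x = sub_act a (sub_act b x).
Proof. by case: x => x Ax; apply: eq_exist; apply: act_comp. Qed.
Definition sub : sSet := SSet sub_act_id sub_act_comp.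

Definition sub_val : smap sub X := @SMap sub X (fun n x => sval x) (fun m n a x => erefl).
End SubComplex.

Definition subc_le (X : sSet) (A B : subc X) : Prop := forall n (x : X n), A n x -> B n x.

Section SubIncl.
Variables (X : sSet) (A B : subc X) (AB : subc_le A B).
Definition sub_incl_fun n (x : sub A n) : sub B n :=
  exist (fun y => B n y) (sval x) (AB (svalP x)).
Lemma sub_incl_act m n (a : omap m n) (x : sub A n) :
  sub_incl_fun (act a x) = act a (sub_incl_fun x).
Proof. exact: eq_exist. Qed.
Definition sub_incl : smap (sub A) (sub B) := SMap sub_incl_act.
End SubIncl.

Lemma face_subproof k (J : seq nat) m n (a : omap m n) (t : Delta k n) :
  [forall i, val (t i) \in J] -> [forall i, val ((act a t : Delta k m) i) \in J].
Proof. by move/forallP=> tJ; apply/forallP=> i; rewrite omkE. Qed.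

(* Delta^J as a subcomplex of Delta^k, for a list J of vertices. *)
Definition face (k : nat) (J : seq nat) : subc (Delta k) :=
  @Subc (Delta k) (fun n t => [forall i, val (t i) \in J]) (@face_subproof k J).

Lemma horn_subproof k (i : nat) m n (a : omap m n) (t : Delta k n) :
  [exists j : 'I_k.+1, (val j != i) && [forall l, t l != j]] ->
  [exists j : 'I_k.+1, (val j != i) && [forall l, (act a t : Delta k m) l != j]].
Proof.
case/existsP=> j /andP[ji /forallP tj]; apply/existsP; exists j; rewrite ji /=.
by apply/forallP=> l; rewrite ffunE.
Qed.

(* Lambda^k_i: the simplices missing some vertex other than i. *)
Definition horn (k i : nat) : subc (Delta k) :=
  @Subc (Delta k) (fun n t => [exists j : 'I_k.+1, (val j != i) && [forall l, t l != j]])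
    (@horn_subproof k i).

Lemma to_point_subproof (X : sSet) m n (a : omap m n) (x : X n) :
  oconst m ord0 = act a (oconst n ord0 : Delta 0 n).
Proof. by apply: omapP => i; rewrite !omkE. Qed.

Definition to_point (X : sSet) : smap X (Delta 0) :=
  @SMap X (Delta 0) (fun n _ => oconst n ord0) (@to_point_subproof X).

Section Pushout.
Variables (A X Y : sSet) (f : smap A X) (g : smap A Y).

Inductive glue n : {classic (X n + Y n)} -> {classic (X n + Y n)} -> Prop :=
  Glue (a : A n) : glue (inl (f n a)) (inr (g n a)).

Definition po_rel n (p q : {classic (X n + Y n)}) : bool :=
  `[< clos_refl_sym_trans _ (@glue n) p q >].

Lemma po_rel_refl n : reflexive (@po_rel n).
Proof. by move=> p; apply/asboolP; apply: rst_refl. Qed.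
Lemma po_rel_sym n : symmetric (@po_rel n).
Proof. by move=> p q; apply/asboolP/asboolP => pq; apply: rst_sym. Qed.
Lemma po_rel_trans n : transitive (@po_rel n).
Proof. by move=> q p r /asboolP pq /asboolP qr; apply/asboolP/(rst_trans _ _ _ _ _ pq qr). Qed.
Canonical po_equiv n := EquivRel (@po_rel n) (@po_rel_refl n) (@po_rel_sym n) (@po_rel_trans n).

Definition po_cell n : Type := {eq_quot (po_equiv n)}.
Definition po_pi n (p : X n + Y n) : po_cell n := \pi_{eq_quot (po_equiv n)} (p : {classic (X n + Y n)}).
Definition po_repr n (q : po_cell n) : X n + Y n := repr q.

Lemma po_reprK n (q : po_cell n) : po_pi (po_repr q) = q.
Proof. exact: reprK. Qed.

Lemma po_piP n (p q : X n + Y n) :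
  po_pi p = po_pi q <-> clos_refl_sym_trans _ (@glue n) p q.
Proof.
split=> [/(@eqmodP _ (po_equiv n))/asboolP //|pq].
by apply/(@eqmodP _ (po_equiv n))/asboolP.
Qed.

Definition sum_act m n (a : omap m n) (p : X n + Y n) : X m + Y m :=
  match p with inl x => inl (act a x) | inr y => inr (act a y) end.

Definition po_act m n (a : omap m n) (q : po_cell n) : po_cell m := po_pi (sum_act a (po_repr q)).

Lemma po_act_pi m n (a : omap m n) (p : X n + Y n) : po_act a (po_pi p) = po_pi (sum_act a p).
Proof.
apply/po_piP; have /po_piP := po_reprK (po_pi p); move: (po_repr _) => q.
elim=> {p q} [_ _ [x]|p|p q _|p q r _ IH1 _ IH2] /=.
- by rewrite -!smap_act; apply: rst_step; apply: Glue.
- exact: rst_refl.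
- exact: rst_sym.
- exact: rst_trans IH1 IH2.
Qed.

Lemma po_act_id n (q : po_cell n) : po_act (oid n) q = q.
Proof. by rewrite -(po_reprK q) po_act_pi; case: (po_repr q) => z /=; rewrite act_id. Qed.

Lemma po_act_comp l m n (a : omap l m) (b : omap m n) (q : po_cell n) :
  po_act (ocomp b a) q = po_act a (po_act b q).
Proof. by rewrite -(po_reprK q) !po_act_pi; case: (po_repr q) => z /=; rewrite act_comp. Qed.

Definition po : sSet := SSet po_act_id po_act_comp.

Lemma po_inl_act m n (a : omap m n) (x : X n) : po_pi (inl (act a x)) = act a (po_pi (inl x) : po n).
Proof. by rewrite /= po_act_pi. Qed.
Definition po_inl : smap X po := @SMap X po (fun n x => po_pi (inl x)) po_inl_act.

Lemma po_inr_act m n (a : omap m n) (y : Y n) : po_pi (inr (act a y)) = act a (po_pi (inr y) : po n).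
Proof. by rewrite /= po_act_pi. Qed.
Definition po_inr : smap Y po := @SMap Y po (fun n y => po_pi (inr y)) po_inr_act.

Lemma po_glue n (x : A n) : po_inl n (f n x) = po_inr n (g n x).
Proof. by apply/po_piP/rst_step/Glue. Qed.

Lemma po_cases n (q : po n) : (exists x, q = po_inl n x) \/ (exists y, q = po_inr n y).
Proof. by rewrite -(po_reprK q); case: (po_repr q) => z; [left|right]; exists z. Qed.

Section Desc.
Variables (Z : sSet) (u : smap X Z) (v : smap Y Z).
Hypothesis uv : smap_eq (smap_comp u f) (smap_comp v g).

Definition sum_desc n (p : X n + Y n) : Z n := match p with inl x => u n x | inr y => v n y end.
Definition po_desc_fun n (q : po n) : Z n := sum_desc (po_repr q).

Lemma po_desc_pi n (p : X n + Y n) : po_desc_fun (po_pi p) = sum_desc p.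
Proof.
rewrite /po_desc_fun; have /po_piP := po_reprK (po_pi p); move: (po_repr _) => q.
by elim=> {p q} [_ _ [x]|p|p q _|p q r _ IH1 _ IH2] //=; [exact: uv|rewrite IH1].
Qed.

Lemma po_desc_act m n (a : omap m n) (q : po n) : po_desc_fun (act a q) = act a (po_desc_fun q).
Proof.
rewrite -(po_reprK q) /= po_act_pi !po_desc_pi.
by case: (po_repr q) => z /=; rewrite smap_act.
Qed.

Definition po_desc : smap po Z := SMap po_desc_act.

Lemma po_desc_inl : smap_eq (smap_comp po_desc po_inl) u.
Proof. by move=> n x; rewrite /= po_desc_pi. Qed.
Lemma po_desc_inr : smap_eq (smap_comp po_desc po_inr) v.
Proof. by move=> n x; rewrite /= po_desc_pi. Qed.
End Desc.
End Pushout.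

(* For subcomplexes A <= B of X, the map
   B \coprod_A Delta^0 -> X \coprod_A Delta^0. *)
Section Collapse.
Variables (X : sSet) (A B : subc X) (AB : subc_le A B).

Definition collapse_sub : sSet := po (sub_incl AB) (to_point (sub A)).
Definition collapse : sSet := po (sub_val A) (to_point (sub A)).

Definition collapse_inl_sub : smap (sub B) collapse_sub := po_inl (sub_incl AB) (to_point (sub A)).
Definition collapse_inl : smap X collapse := po_inl (sub_val A) (to_point (sub A)).

Lemma collapse_map_subproof :
  smap_eq (smap_comp (smap_comp collapse_inl (sub_val B)) (sub_incl AB))
    (smap_comp (po_inr (sub_val A) (to_point (sub A))) (to_point (sub A))).
Proof. by move=> n x; apply: (po_glue (sub_val A) (to_point (sub A)) x). Qed.

Definition collapse_map : smap collapse_sub collapse := po_desc collapse_map_subproof.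
End Collapse.

Record scsSet := ScSSet {
  carrier :> sSet;
  thin : carrier 2 -> Prop;
  thin_degenerate : forall t : carrier 2, degenerate t -> thin t }.
Arguments thin {s} t.

Record scmap (X Y : scsSet) := ScMap {
  scmap_map :> smap X Y;
  scmap_thin : forall t : X 2, thin t -> thin (scmap_map 2 t) }.

Definition scmap_id (X : scsSet) : scmap X X := @ScMap X X (smap_id X) (fun t th => th).

Definition scmap_comp (X Y Z : scsSet) (g : scmap Y Z) (f : scmap X Y) : scmap X Z :=
  @ScMap X Z (smap_comp g f) (fun t th => scmap_thin g (scmap_thin f th)).

Definition tri (X : sSet) := X 2 -> Prop.

(* (X, T): the thin triangles are those of T and the degenerate ones. *)
Definition scale (X : sSet) (T : tri X) : scsSet :=
  @ScSSet X (fun t => T t \/ degenerate t) (fun t Dt => or_intror Dt).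

Definition flat (X : sSet) : scsSet := scale (fun _ : X 2 => False).

Definition restr (X : sSet) (T : tri X) (B : subc X) : tri (sub B) := fun t => T (sval t).
Arguments restr {X} T B.

Definition image_tri (X Y : sSet) (f : smap X Y) (T : tri X) : tri Y :=
  fun t => exists2 s, T s & t = f 2 s.

Section ScaleMap.
Variables (X Y : sSet) (T : tri X) (T' : tri Y) (f : smap X Y).
Hypothesis fT : forall t, T t -> T' (f 2 t).
Lemma scale_map_thin (t : scale T 2) : thin t -> @thin (scale T') (f 2 t).
Proof. by case=> [/fT ?|/(degenerate_smap f) ?]; [left|right]. Qed.
Definition scale_map : scmap (scale T) (scale T') := @ScMap (scale T) (scale T') f scale_map_thin.
End ScaleMap.

Definition flat_map (X Y : sSet) (f : smap X Y) : scmap (flat X) (flat Y) :=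
  @scale_map X Y _ _ f (fun t F => F).

Definition sub_scale_map (X : sSet) (T : tri X) (B : subc X) : scmap (scale (restr T B)) (scale T) :=
  @scale_map (sub B) X _ T (sub_val B) (fun t Tt => Tt).

(* (B \coprod_A Delta^0, T_{|B}) -> (X \coprod_A Delta^0, T), for T a set of
   triangles of X, identified with its image in the pushout. *)
Section CollapseScale.
Variables (X : sSet) (T : tri X) (A B : subc X) (AB : subc_le A B).

Lemma collapse_scale_subproof (t : collapse_sub AB 2) :
  image_tri (collapse_inl_sub AB) (restr T B) t -> image_tri (collapse_inl A) T (collapse_map AB 2 t).
Proof.
case=> s Ts ->; exists (sval s) => //.
exact: (po_desc_inl (collapse_map_subproof AB) s).
Qed.

Definition collapse_scale_map :
  scmap (scale (image_tri (collapse_inl_sub AB) (restr T B)))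
        (scale (image_tri (collapse_inl A) T)) :=
  scale_map collapse_scale_subproof.
End CollapseScale.

Section ScaledPushout.
Variables (A X Y : scsSet) (f : scmap A X) (g : scmap A Y).

Definition spo_thin (t : po f g 2) : Prop :=
  image_tri (po_inl f g) (@thin X) t \/ image_tri (po_inr f g) (@thin Y) t.

Lemma spo_thin_degenerate (t : po f g 2) : degenerate t -> spo_thin t.
Proof.
case=> i [y ->]; case: (po_cases y) => -[z ->]; [left|right];
  exists (act (codeg i) z); rewrite ?smap_act //; apply: thin_degenerate; by exists i, z.
Qed.

Definition spo : scsSet := ScSSet spo_thin_degenerate.

Definition spo_inl : scmap X spo :=
  @ScMap X spo (po_inl f g) (fun t th => or_introl (ex_intro2 _ _ t th erefl)).
Definition spo_inr : scmap Y spo :=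
  @ScMap Y spo (po_inr f g) (fun t th => or_intror (ex_intro2 _ _ t th erefl)).

Section Desc.
Variables (Z : scsSet) (u : scmap X Z) (v : scmap Y Z).
Hypothesis uv : smap_eq (scmap_comp u f) (scmap_comp v g).

Lemma spo_desc_thin (t : spo 2) : thin t -> thin (po_desc (uv : smap_eq (smap_comp u f) (smap_comp v g)) 2 t).
Proof.
case=> -[s th ->].
  by have /= -> := @po_desc_inl _ _ _ f g _ u v uv _ s; apply: scmap_thin.
by have /= -> := @po_desc_inr _ _ _ f g _ u v uv _ s; apply: scmap_thin.
Qed.
Definition spo_desc : scmap spo Z := ScMap spo_desc_thin.
End Desc.
End ScaledPushout.

Section Product.
Variables X Y : sSet.
Definition prod_act m n (a : omap m n) (p : X n * Y n) : X m * Y m := (act a p.1, act a p.2).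
Lemma prod_act_id n p : @prod_act n n (oid n) p = p.
Proof. by case: p => x y; rewrite /prod_act /= !act_id. Qed.
Lemma prod_act_comp l m n (a : omap l m) (b : omap m n) p :
  prod_act (ocomp b a) p = prod_act a (prod_act b p).
Proof. by rewrite /prod_act /= !act_comp. Qed.
Definition sprod : sSet := @SSet (fun n => (X n * Y n)%type) prod_act prod_act_id prod_act_comp.
End Product.

Section Gray.
Variables X Y : scsSet.

Definition gray_thin (t : sprod X Y 2) : Prop :=
  [/\ thin t.1, thin t.2 &
    degenerate_along (inord 1 : 'I_2) t.1 \/ degenerate_along (inord 0 : 'I_2) t.2].

Lemma degenerate_along_codeg (Z : sSet) (i : 'I_2) (z : Z 1) : degenerate_along i (act (codeg i) z).
Proof.
split; first by exists i, z.
exists ord0, (act (oconst 0 i) z); rewrite -!act_comp; congr act.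
apply: omapP => j; rewrite !omkE; apply: val_inj => /=.
by case: i j => [[|[|]]] // ? [[|[|]]].
Qed.

Lemma gray_thin_degenerate (t : sprod X Y 2) : degenerate t -> gray_thin t.
Proof.
case=> i [[x y] ->]; split=> /=; try by apply: thin_degenerate; exists i; [exists x | exists y].
  by apply: thin_degenerate; exists i, x.
  by apply: thin_degenerate; exists i, y.
have [->|->] : i = inord 1 \/ i = inord 0.
- by case: i => -[|[|//]] Hi; [right|left]; apply: val_inj; rewrite /= inordK.
- by left; apply: degenerate_along_codeg.
- by right; apply: degenerate_along_codeg.
Qed.

Definition gray : scsSet := ScSSet gray_thin_degenerate.
End Gray.

Section GrayMap.
Variables (X X' Y Y' : scsSet) (f : scmap X X') (g : scmap Y Y').
Definition gray_map_fun n (p : gray X Y n) : gray X' Y' n := (f n p.1, g n p.2).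
Lemma gray_map_act m n (a : omap m n) (p : gray X Y n) :
  gray_map_fun (act a p) = act a (gray_map_fun p).
Proof. by rewrite /gray_map_fun /= /prod_act /= !smap_act. Qed.
Lemma gray_map_thin (t : gray X Y 2) : thin t -> thin (SMap gray_map_act 2 t).
Proof.
case=> t1 t2 t12; split; rewrite /=; try exact: scmap_thin.
by case: t12 => D; [left|right]; apply: degenerate_along_smap.
Qed.
Definition gray_map : scmap (gray X Y) (gray X' Y') := ScMap gray_map_thin.
End GrayMap.

Definition rlp (A B X Y : sSet) (i : smap A B) (f : smap X Y) : Prop :=
  forall (u : smap A X) (v : smap B Y), smap_eq (smap_comp f u) (smap_comp v i) ->
  exists w : smap B X, smap_eq (smap_comp w i) u /\ smap_eq (smap_comp f w) v.

Definition is_lift (A B X Y : scsSet) (i : scmap A B) (f : scmap X Y)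
    (u : scmap A X) (v : scmap B Y) (w : scmap B X) : Prop :=
  smap_eq (scmap_comp w i) u /\ smap_eq (scmap_comp f w) v.

Definition srlp (A B X Y : scsSet) (i : scmap A B) (f : scmap X Y) : Prop :=
  forall (u : scmap A X) (v : scmap B Y), smap_eq (scmap_comp f u) (scmap_comp v i) ->
  exists w, is_lift i f u v w.

Definition ext_prop (A B X : scsSet) (i : scmap A B) : Prop :=
  forall u : scmap A X, exists w : scmap B X, smap_eq (scmap_comp w i) u.

Definition tri_set (k : nat) (l : seq (seq nat)) : tri (Delta k) := fun t => vertices t \in l.
Arguments tri_set : clear implicits.

Definition inner_horn_map (n i : nat) :=
  sub_scale_map (tri_set n [:: [:: i.-1; i; i.+1]]) (horn n i).

Definition saturation_T : seq (seq nat) :=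
  [:: [:: 0; 2; 4]; [:: 1; 2; 3]; [:: 0; 1; 3]; [:: 1; 3; 4]; [:: 0; 1; 2]].

Lemma saturation_subproof (t : Delta 4 2) : tri_set 4 saturation_T t ->
  tri_set 4 (saturation_T ++ [:: [:: 0; 3; 4]; [:: 0; 1; 4]]) (smap_id _ _ t).
Proof. by rewrite /tri_set mem_cat => ->. Qed.

Definition saturation_map := scale_map saturation_subproof.

Lemma left_edge_le n (n2 : 2 <= n) : subc_le (face n [:: 0; 1]) (horn n 0).
Proof.
move=> m t /forallP tJ; apply/existsP; exists (Ordinal (n2 : 2 < n.+1)) => /=.
by apply/forallP=> l; apply/eqP=> tl; have := tJ l; rewrite tl !inE.
Qed.

Lemma right_edge_le n (n2 : 2 <= n) : subc_le (face n [:: n.-1; n]) (horn n n).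
Proof.
move=> m t /forallP tJ; apply/existsP; exists ord0 => /=.
case: n n2 t tJ => [|[|n]] // _ t tJ; rewrite /=.
by apply/forallP=> l; apply/eqP=> tl; have := tJ l; rewrite tl !inE.
Qed.

(* Lambda^n_0 \coprod_{Delta^{0,1}} Delta^0 -> Delta^n \coprod_{Delta^{0,1}} Delta^0,
   without scaling and with scaling {Delta^{0,1,n}}. *)
Definition left_map n (n2 : 2 <= n) := collapse_map (left_edge_le n2).
Definition left_scaled_map n (n2 : 2 <= n) :=
  collapse_scale_map (tri_set n [:: [:: 0; 1; n]]) (left_edge_le n2).

(* Lambda^n_n \coprod_{Delta^{n-1,n}} Delta^0 -> Delta^n \coprod_{Delta^{n-1,n}} Delta^0,
   without scaling and with scaling {Delta^{0,n-1,n}}. *)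
Definition right_map n (n2 : 2 <= n) := collapse_map (right_edge_le n2).
Definition right_scaled_map n (n2 : 2 <= n) :=
  collapse_scale_map (tri_set n [:: [:: 0; n.-1; n]]) (right_edge_le n2).

Definition cartesian_horn_map n :=
  sub_scale_map (tri_set n [:: [:: 0; n.-1; n]]) (horn n n).

(* For n >= 3 the triangle Delta^{0,1,n} lies in Lambda^n_0, so the scaling of
   the source of left_scaled_map is {Delta^{0,1,n}} itself. *)
Definition infty_bicategory (X : scsSet) : Prop :=
  [/\ forall n i, 0 < i < n -> ext_prop X (inner_horn_map n i),
      ext_prop X saturation_map &
      forall n (n3 : 3 <= n), ext_prop X (left_scaled_map (ltnW n3))].

Definition weak_fibration (X Y : scsSet) (f : scmap X Y) : Prop :=
  [/\ forall n i, 0 < i < n -> srlp (inner_horn_map n i) f,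
      forall n (n2 : 2 <= n), srlp (left_scaled_map n2) f &
      forall n (n2 : 2 <= n), srlp (right_scaled_map n2) f].

Definition outer_fibration (X Y : scsSet) (f : scmap X Y) : Prop :=
  [/\ weak_fibration f,
      forall t : X 2, thin t <-> thin (f 2 t),
      forall n (n2 : 2 <= n), rlp (left_map n2) f &
      forall n (n2 : 2 <= n), rlp (right_map n2) f].

Definition cartesian_edge (X Y : scsSet) (f : scmap X Y) (e : X 1) : Prop :=
  forall n (u : scmap (scale (restr (tri_set n [:: [:: 0; n.-1; n]]) (horn n n))) X)
    (v : scmap (scale (tri_set n [:: [:: 0; n.-1; n]])) Y),
  2 <= n -> smap_eq (scmap_comp f u) (scmap_comp v (cartesian_horn_map n)) ->
  (forall d : sub (horn n n) 1, vertices (sval d) = [:: n.-1; n] -> u 1 d = e) ->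
  exists w, is_lift (cartesian_horn_map n) f u v w.

Notation Delta1 := (flat (Delta 1)).
(* The subcomplex Delta^{1} of Delta^1; every one of its triangles is degenerate. *)
Notation End1 := (flat (sub (face 1 [:: 1]))).

Definition end1_incl : scmap End1 Delta1 := flat_map (sub_val (face 1 [:: 1])).

Section Cylinder.
Variables (K L : scsSet) (k : scmap K L).

(* (Delta^{1} (x) L) \coprod_{Delta^{1} (x) K} (Delta^1 (x) K) *)
Definition cyl_dom : scsSet := spo (gray_map (scmap_id End1) k) (gray_map end1_incl (scmap_id K)).

Lemma cyl_incl_subproof :
  smap_eq (scmap_comp (gray_map end1_incl (scmap_id L)) (gray_map (scmap_id End1) k))
          (scmap_comp (gray_map (scmap_id Delta1) k) (gray_map end1_incl (scmap_id K))).
Proof. by []. Qed.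

Definition cyl_incl : scmap cyl_dom (gray Delta1 L) := spo_desc cyl_incl_subproof.

Definition cyl_end : scmap (gray End1 L) cyl_dom := spo_inl _ _.
Definition cyl_sub : scmap (gray Delta1 K) cyl_dom := spo_inr _ _.
End Cylinder.

(* The edge Delta^1 x {u} of Delta^1 x L. *)
Definition cyl_edge (L : scsSet) (u : L 0) : gray Delta1 L 1 :=
  (oid 1 : Delta 1 1, act (codeg ord0) u).

Lemma end1_subproof : face 1 [:: 1] 0 (oconst 0 ord_max).
Proof. by apply/forallP=> i; rewrite omkE. Qed.

(* The vertex Delta^{1} x {u} of Delta^{1} x L. *)
Definition cyl_vertex (L : scsSet) (u : L 0) : gray End1 L 0 :=
  (exist (fun t => face 1 [:: 1] 0 t) (oconst 0 ord_max) end1_subproof, u).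

(* The thin triangles of K need not be all those of L lying in K. *)
Definition inclusion (K L : scsSet) (k : scmap K L) : Prop := forall n, injective (k n).

(* K is identified with its image in L: u lies in L_0 \ K_0. *)
Definition new_vertex (K L : scsSet) (k : scmap K L) (u : L 0) : Prop :=
  ~ exists v : K 0, k 0 v = u.

(* e is an f-cartesian edge with target alpha(Delta^{1} x {u}) lifting
   H(Delta^1 x {u}). *)
Definition cartesian_lift (E B : scsSet) (f : scmap E B) (K L : scsSet) (k : scmap K L)
    (alpha : scmap (cyl_dom k) E) (H : scmap (gray Delta1 L) B) (u : L 0) (e : E 1) : Prop :=
  [/\ cartesian_edge f e,
      target e = alpha 0 (cyl_end k 0 (cyl_vertex u)) &
      f 1 e = H 1 (cyl_edge u)].

(* Main.v *)
Require Import Defs.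
From mathcomp Require Import all_boot boolp zify.
Import Defs.

Set Implicit Arguments.
Unset Strict Implicit.
Unset Printing Implicit Defensive.

(** The lift is built simplex by simplex over L.  Thinness is no issue: f detects
    thin triangles and the lift lies over the scaled map H, so every simplicial
    lift is automatically scaled.  Over a new vertex the lift is the chosen
    cartesian edge.  Over a new nondegenerate n-simplex with n > 0 the lift is
    known on the boundary cylinder and on the end {1}, and the remaining prism is
    filled along the chains

      (0,0) < ... < (0,i) < (1,i) < ... < (1,n),    i = 0, ..., n

    ([prism_fill]).  The i-th chain is an (n+1)-simplex whose faces are all known
    except the one opposite (1,i).  For i < n this is an inner horn, and the
    triangle (0,i), (1,i), (1,i+1) is thin in the Gray product, so that the
    scaled inner horn lifts.  For i = n it is an outer horn whose last edge
    (0,n) -> (1,n) is cartesian.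

    That last step hides the difficulty: the triangle (0,0), (0,n), (1,n) is not
    thin in the Gray product, whereas cartesian edges are only assumed to lift
    horns in which it is.  The lemma [cartesian_horn_lift] shows that for an outer
    fibration over an infinity-bicategory the thinness condition can be dropped.
    Let b be an m-simplex of B with last edge f(e) : y -> z.  A composite vertex z'
    is inserted between y and z, with z' -> z degenerate, so that the triangles
    (i, y, z') are thin; such an (m+1)-simplex T exists by inner horns in B
    ([composite_exists]).  The faces of T that end in the degenerate edge z' -> z and
    omit some vertex up to y are lifted along horns opposite z, because f lifts
    outer horns with collapsed last edge ([lift_off_composite]).  The face of T opposite z is then
    a cartesian horn whose relevant triangle is thin, so it lifts, and a last
    inner horn at z' gives T itself; its face opposite z' is the lift of b.

    Partial maps between simplicial sets are total families of functions that are
    required to commute with simplicial operators on a predicate closed under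
    these operators.  This makes extending a map along a horn a case
    distinction ([attach]), with no gluing of subcomplexes. *)

(** * Extending partial maps *)

Definition act_closed (X : sSet) (A : forall n, X n -> Prop) : Prop :=
  forall m n (a : omap m n) (x : X n), A n x -> A m (act a x).

Definition natural_on (X Y : sSet) (A : forall n, X n -> Prop) (w : forall n, X n -> Y n) : Prop :=
  forall m n (a : omap m n) (x : X n), A n x -> w m (act a x) = act a (w n x).

Definition act_closed2 (X Y : sSet) (Q : forall n, X n -> Y n -> Prop) : Prop :=
  forall m n (a : omap m n) (x : X n) (y : Y n), Q n x y -> Q m (act a x) (act a y).

(** The cell x is a retract of X through rho, so a simplex s lies in the image of
    x exactly when x composed with rho s is s again, and its value is then read off from
    y along rho s.  The relation Q carries what the values have to satisfy, such
    as lying over a given map. *)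
Lemma attach (X Y : sSet) (A : forall n, X n -> Prop) (Q : forall n, X n -> Y n -> Prop)
    (w : forall n, X n -> Y n) m (x : X m) (y : Y m) (rho : forall n, X n -> omap n m) :
  act_closed A -> act_closed2 Q -> natural_on A w -> (forall n s, A n s -> Q n s (w n s)) ->
  (forall l n (a : omap l n) (s : X n), rho l (act a s) = ocomp (rho n s) a) ->
  rho m x = oid m -> Q m x y ->
  (forall r (t : omap r m), A r (act t x) -> act t y = w r (act t x)) ->
  exists w' : forall n, X n -> Y n,
    [/\ natural_on (fun n s => A n s \/ act (rho n s) x = s) w',
        forall n s, A n s \/ act (rho n s) x = s -> Q n s (w' n s) &
        forall n s, A n s -> w' n s = w n s].
Proof.
move=> clA clQ natw Qw rhoA rhox Qxy yw.
have old n s : A n s -> act (rho n s) x = s -> act (rho n s) y = w n s.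
  by move=> As sx; rewrite yw sx.
exists (fun n s => if `[< act (rho n s) x = s >] then act (rho n s) y else w n s); split.
- move=> l n a s As.
  have [sx|sx] := asboolP (act (rho n s) x = s).
    by rewrite asboolT rhoA act_comp ?sx.
  case: As => // As; have [asx|_] := asboolP; last exact: natw.
  by rewrite (old _ _ _ asx) ?natw //; apply: clA.
- move=> n s As; have [sx|sx] := asboolP; last by case: As => // /Qw.
  by rewrite -{1}sx; apply: clQ.
- by move=> n s As; have [/(old _ _ As)|] := asboolP.
Qed.

(** * Horn lifts of cells *)
Section HornMap.
Variables (k i : nat) (Y : sSet) (w : forall r, omap r k -> Y r).
Hypothesis natw : natural_on (X := Delta k) (fun r t => horn k i r t) w.
Lemma horn_map_act m n (a : omap m n) (x : sub (horn k i) n) :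
  w (sval (act a x)) = act a (w (sval x)).
Proof. exact: (natw a (svalP x)). Qed.
Definition horn_map : smap (sub (horn k i)) Y :=
  @SMap (sub (horn k i)) Y (fun n x => w (sval x)) horn_map_act.
End HornMap.

Definition yoneda (Y : sSet) k (b : Y k) : smap (Delta k) Y :=
  @SMap (Delta k) Y (fun n t => act t b) (fun m n a t => act_comp a t b).

Lemma smap_yoneda (Y : sSet) k (g : smap (Delta k) Y) r (t : omap r k) :
  g r t = act t (g k (oid k)).
Proof.
rewrite -smap_act; congr (g r _); apply: omapP => i; by rewrite !omkE.
Qed.

Lemma scale_smap_thin (X : sSet) (T : tri X) (Z : scsSet) (g : smap X Z) :
  (forall t, T t -> thin (g 2 t)) -> forall t : scale T 2, thin t -> thin (g 2 t).
Proof. by move=> gT t [/gT//|/(degenerate_smap g)/thin_degenerate]. Qed.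

(** The middle triangle of y is thin even when it is not a simplex of the horn:
    this is how composites of edges arise (k = 2). *)
Lemma inner_horn_extension (B : scsSet) k i (w : forall r, omap r k -> B r) :
  infty_bicategory B -> 0 < i < k ->
  natural_on (X := Delta k) (fun r t => horn k i r t) w ->
  (forall t : omap 2 k, vertices t = [:: i.-1; i; i.+1] -> horn k i 2 t -> thin (w 2 t)) ->
  exists y : B k, (forall r (t : omap r k), horn k i r t -> act t y = w r t) /\
    (forall t : omap 2 k, vertices t = [:: i.-1; i; i.+1] -> thin (act t y)).
Proof.
case=> [inn _ _] ik natw thw.
have uT : forall t : scale (restr (tri_set k [:: [:: i.-1; i; i.+1]]) (horn k i)) 2,
    thin t -> thin (horn_map natw 2 t).
  apply: scale_smap_thin => -[t ht]; rewrite /restr /tri_set /= inE => /eqP tv.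
  exact: thw.
have [g gu] := inn k i ik (ScMap uT).
exists (g k (oid k)); split=> [r t ht|t tv].
  by rewrite -smap_yoneda; apply: (gu r (exist _ t ht)).
rewrite -smap_yoneda; apply: (scmap_thin g); left; by rewrite /tri_set inE; apply/eqP.
Qed.

Section Lifts.
Variables (E B : scsSet) (f : scmap E B) (hf : outer_fibration f).

Lemma thin_over t : thin t <-> thin (f 2 t).
Proof. by case: hf. Qed.

Variables (k i : nat) (b : B k) (w : forall r, omap r k -> E r).
Hypothesis natw : natural_on (X := Delta k) (fun r t => horn k i r t) w.
Hypothesis overw : forall r (t : omap r k), horn k i r t -> f r (w t) = act t b.

Section Scaled.
Variable T : tri (Delta k).
Hypothesis bT : forall t : omap 2 k, T t -> thin (act t b).

Lemma bottom_thin (t : scale T 2) : thin t -> thin (yoneda b 2 t).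
Proof. by apply: scale_smap_thin. Qed.

(** Since f detects thin triangles, thinness of the horn in E is inherited from
    its image in B. *)
Lemma top_thin (t : scale (restr T (horn k i)) 2) : thin t -> thin (horn_map natw 2 t).
Proof.
apply: scale_smap_thin => -[s hs] Ts /=; apply/thin_over; rewrite overw //.
exact: bT.
Qed.

Lemma horn_square : smap_eq (smap_comp f (ScMap top_thin))
  (smap_comp (ScMap bottom_thin) (sub_scale_map T (horn k i))).
Proof. by move=> n x; apply: overw (svalP x). Qed.

Lemma cell_of_lift :
  (exists g, is_lift (sub_scale_map T (horn k i)) f (ScMap top_thin) (ScMap bottom_thin) g) ->
  exists y : E k, f k y = b /\ forall r (t : omap r k), horn k i r t -> act t y = w t.
Proof.
case=> g [gu gv]; exists (g k (oid k)); split.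
  by have := gv k (oid k); rewrite /= act_id.
by move=> r t ht; rewrite -smap_yoneda; apply: (gu r (exist _ t ht)).
Qed.
End Scaled.

Lemma inner_horn_lift : 0 < i < k ->
  (forall t : omap 2 k, vertices t = [:: i.-1; i; i.+1] -> thin (act t b)) ->
  exists y : E k, f k y = b /\ forall r (t : omap r k), horn k i r t -> act t y = w t.
Proof.
move=> ik thb; have [[inn _ _] _ _ _] := hf.
have bT t : tri_set k [:: [:: i.-1; i; i.+1]] t -> thin (act t b).
  by rewrite /tri_set inE => /eqP/thb.
by apply: (cell_of_lift (bT := bT)); apply: (inn k i ik); apply: horn_square.
Qed.

End Lifts.

Lemma thin_cartesian_horn_lift (E B : scsSet) (f : scmap E B) (hf : outer_fibration f) k
    (b : B k) (w : forall r, omap r k -> E r) (e : E 1) :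
  2 <= k -> natural_on (X := Delta k) (fun r t => horn k k r t) w ->
  (forall r (t : omap r k), horn k k r t -> f r (w r t) = act t b) ->
  (forall t : omap 2 k, vertices t = [:: 0; k.-1; k] -> thin (act t b)) ->
  cartesian_edge f e -> (forall t : omap 1 k, vertices t = [:: k.-1; k] -> w 1 t = e) ->
  exists y : E k, f k y = b /\ forall r (t : omap r k), horn k k r t -> act t y = w r t.
Proof.
move=> k2 natw overw thb ce we.
have bT t : tri_set k [:: [:: 0; k.-1; k]] t -> thin (act t b).
  by rewrite /tri_set inE => /eqP/thb.
apply: (cell_of_lift (hf := hf) (natw := natw) (overw := overw) (bT := bT)).
apply: ce => //; first exact: horn_square.
by move=> d; apply: we.
Qed.

(** A horn whose last edge is degenerate is a horn on the simplex with that edge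
    collapsed, and there f lifts without any thinness condition. *)
Lemma collapsed_horn_lift (E B : scsSet) (f : scmap E B) (hf : outer_fibration f) k
    (b : B k) (w : forall r, omap r k -> E r) (z : E 0) :
  2 <= k -> natural_on (X := Delta k) (fun r t => horn k k r t) w ->
  (forall r (t : omap r k), horn k k r t -> f r (w r t) = act t b) ->
  (forall r (t : omap r k), face k [:: k.-1; k] r t -> w r t = act (oconst r ord0) z) ->
  exists y : E k, f k y = b /\ forall r (t : omap r k), horn k k r t -> act t y = w r t.
Proof.
move=> k2 natw overw wz; have [_ _ _ hr] := hf.
have AB := right_edge_le k2.
have cu : smap_eq (smap_comp (horn_map natw) (sub_incl (right_edge_le k2)))
    (smap_comp (yoneda z) (to_point (sub (face k [:: k.-1; k])))).
  by move=> n [t tf] /=; apply: wz.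
have cv : smap_eq (smap_comp (yoneda b) (sub_val (face k [:: k.-1; k])))
    (smap_comp (yoneda (f 0 z)) (to_point (sub (face k [:: k.-1; k])))).
  by move=> n [t tf] /=; rewrite -overw ?wz ?smap_act //; apply: AB.
have [|g [gu gv]] := hr k k2 (po_desc cu) (po_desc cv).
  move=> n q; case: (po_cases q) => -[x ->] /=;
    rewrite (po_desc_pi cu) (po_desc_pi (collapse_map_subproof (right_edge_le k2)))
    (po_desc_pi cv) /=.
    by apply: overw; case: x.
  by rewrite smap_act.
exists (g k (collapse_inl (face k [:: k.-1; k]) k (oid k))); split.
  have /= := gv k (collapse_inl (face k [:: k.-1; k]) k (oid k)).
  by rewrite (po_desc_pi cv) /= act_id.
move=> r t ht.
have /= := gu r (collapse_inl_sub (right_edge_le k2) r (exist _ t ht)).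
rewrite (po_desc_pi cu) (po_desc_pi (collapse_map_subproof (right_edge_le k2))) /= => <-.
rewrite -smap_act /= po_act_pi /=.
by congr (g r (po_pi _ _ (inl _))); apply: omapP => i; rewrite !omkE.
Qed.

(** * Filling a family of faces in pairs *)
#[global] Arguments ocomp : simpl never.
#[global] Arguments omk : simpl never.
#[global] Arguments codeg : simpl never.
#[global] Arguments oseg : simpl never.

Lemma ocompE l m n (b : omap m n) (a : omap l m) i : ocomp b a i = b (a i).
Proof. exact: omkE. Qed.

Definition vertex_set m n (t : omap m n) : {set 'I_n.+1} := [set t i | i in 'I_m.+1].

Lemma mem_vertex_set m n (t : omap m n) i : t i \in vertex_set t.
Proof. exact: imset_f. Qed.

Lemma vertex_set_ocomp l m n (b : omap m n) (a : omap l m) :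
  vertex_set (ocomp b a) \subset vertex_set b.
Proof. by apply/subsetP => _ /imsetP[i _ ->]; rewrite omkE mem_vertex_set. Qed.

Lemma hornP k (i : 'I_k.+1) n (t : omap n k) :
  reflect (exists2 j, j != i & j \notin vertex_set t) (horn k i n t).
Proof.
apply: (iffP existsP) => [[j /andP[ji /forallP tj]]|[j ji jt]]; exists j => //.
  by apply/imsetP => -[l _ jl]; move: (tj l); rewrite -jl eqxx.
rewrite ji; apply/forallP => l; apply: contraNneq jt => <-; exact: mem_vertex_set.
Qed.

Lemma ocompA k l m n (c : omap m n) (b : omap l m) (a : omap k l) :
  ocomp c (ocomp b a) = ocomp (ocomp c b) a.
Proof. exact: Delta_comp. Qed.

Lemma Delta_idl m n (t : omap m n) : ocomp (oid n) t = t.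
Proof. by apply: omapP => i; rewrite !omkE. Qed.

(** A face together with a retraction onto it: the form in which faces enter
    [attach]. *)
Definition face_retract N (S : {set 'I_N.+1}) m (x : omap m N) (rho : omap N m) :=
  [/\ forall i, rho (x i) = i, forall i, x i \in S & forall i, i \in S -> x (rho i) = i].

(** The retraction counts the elements of S below a vertex. *)
Lemma face_retract_exists N (S : {set 'I_N.+1}) i0 : i0 \in S ->
  exists m (x : omap m N) (rho : omap N m), face_retract S x rho.
Proof.
move=> i0S; pose m := #|S|.-1.
have cS : #|S| = m.+1 by rewrite prednK //; apply/card_gt0P; exists i0.
pose rk (i : 'I_N.+1) := #|[set j in S | j < i]|.
have rk_mono (i j : 'I_N.+1) : i <= j -> rk i <= rk j.
  move=> ij; apply/subset_leq_card/subsetP => l; rewrite !inE => /andP[->] li.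
  exact: leq_trans li ij.
have rk_lt (i j : 'I_N.+1) : i \in S -> i < j -> rk i < rk j.
  move=> iS ij; apply/proper_card/properP; split.
    by apply/subsetP => l; rewrite !inE => /andP[->] li; apply: ltn_trans li ij.
  by exists i; rewrite !inE ?iS ?ij ?ltnn.
have rk_max i : i \in S -> rk i < m.+1.
  move=> iS; rewrite -cS; apply/proper_card/properP; split.
    by apply/subsetP => l; rewrite !inE => /andP[].
  by exists i; rewrite // !inE ltnn andbF.
have rhoS i : minn (rk i) m < m.+1 by rewrite ltnS geq_minr.
have rho_mono (i j : 'I_N.+1) : i <= j -> Ordinal (rhoS i) <= Ordinal (rhoS j).
  by move=> /rk_mono /= ?; lia.
pose rho := omk rho_mono.
have rhoE i : i \in S -> rho i = rk i :> nat.
  by move=> /rk_max ?; rewrite omkE /=; lia.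
have rho_inj : {in S &, injective rho}.
  move=> i j iS jS /(congr1 val); rewrite /= !rhoE // => eq_rk; apply: val_inj.
  by case: (ltngtP i j) => // /rk_lt => [/(_ iS)|/(_ jS)]; rewrite eq_rk ltnn.
have rho_onto : rho @: S = setT.
  by apply/eqP; rewrite eqEcard subsetT /= (card_in_imset rho_inj) cS cardsT card_ord.
have /boolp.choice[x0 x0P] (l : 'I_m.+1) : exists s, s \in S /\ rho s = l.
  have : l \in rho @: S by rewrite rho_onto inE.
  by case/imsetP => s sS ->; exists s.
have x0_mono (i j : 'I_m.+1) : i <= j -> x0 i <= x0 j.
  move=> ij; rewrite leqNgt; apply/negP => ji.
  have [[iS ei] [jS ej]] := (x0P i, x0P j).
  by have := rk_lt _ _ jS ji; rewrite -!rhoE // ei ej; lia.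
exists m, (omk x0_mono), rho; split=> [i|i|i iS]; rewrite (omkE x0_mono); try by case: (x0P i).
by apply: rho_inj => //; case: (x0P (rho i)).
Qed.

Lemma face_retract_lt N (S : {set 'I_N.+1}) m (x : omap m N) (rho : omap N m) (u v : 'I_N.+1) :
  face_retract S x rho -> u \in S -> v \in S -> u < v -> rho u < rho v.
Proof.
move=> [_ _ xr] uS vS uv; rewrite ltnNge; apply/negP => /(omap_leq x); rewrite !xr //; lia.
Qed.

Lemma face_retract_succ N (S : {set 'I_N.+1}) m (x : omap m N) (rho : omap N m) (u v : 'I_N.+1) :
  face_retract S x rho -> u \in S -> v \in S -> u < v ->
  (forall s : 'I_N.+1, s \in S -> u < s -> v <= s) -> rho v = (rho u).+1 :> nat.
Proof.
move=> fr uS vS uv nb; have lt := face_retract_lt fr uS vS uv.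
apply/eqP; rewrite eqn_leq lt andbT; have [rx xS xr] := fr.
have hm : (rho u).+1 < m.+1 by apply: leq_trans lt _; rewrite -ltnS.
pose l := Ordinal hm.
have /(omap_leq rho) : v <= x l; last by rewrite rx.
apply: nb => //; rewrite ltnNge; apply/negP => /(omap_leq rho); rewrite rx /=; lia.
Qed.

Lemma vertex_set_face_retract N (S : {set 'I_N.+1}) m (x : omap m N) (rho : omap N m) :
  face_retract S x rho -> vertex_set x = S.
Proof.
move=> [_ xS xr]; apply/setP => i; apply/imsetP/idP => [[j _ ->] //|iS].
by exists (rho i); rewrite ?xr.
Qed.

Definition core N (v q : 'I_N.+1) n (t : omap n N) := vertex_set t :\ v :\ q.

Lemma core_act N (v q : 'I_N.+1) m n (t : omap n N) (a : omap m n) :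
  core v q (ocomp t a) \subset core v q t.
Proof. by rewrite /core !setSD ?vertex_set_ocomp. Qed.

(** Faces of Delta^N containing q are added in pairs: for U avoiding v and q, the
    faces U + q and U + v + q together are one horn at v, whose other faces are
    U + v, known from the start, and pairs for smaller U.  A map given on the faces
    without q, and on those whose vertices other than v and q lie in D, therefore
    extends as soon as these horns can be filled. *)
Section PairFill.
Variables (Y : sSet) (N : nat) (v q : 'I_N.+1).
Variables (F : {set {set 'I_N.+1}}) (D : {set 'I_N.+1}).
Variables (Q : forall n, omap n N -> Y n -> Prop) (w0 : forall n, omap n N -> Y n).
Hypotheses (vq : v != q) (dcF : forall U U' : {set 'I_N.+1}, U' \subset U -> U \in F -> U' \in F).
Hypothesis clQ : act_closed2 (X := Delta N) Q.

Definition pair_dom (G : {set {set 'I_N.+1}}) n (t : omap n N) : Prop :=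
  core v q t \in F /\ [|| q \notin vertex_set t, core v q t \subset D | core v q t \in G].

Definition pair_start n (t : omap n N) : Prop :=
  core v q t \in F /\ (q \notin vertex_set t) || (core v q t \subset D).

Hypotheses (natw0 : natural_on (X := Delta N) pair_start w0)
  (Qw0 : forall n t, pair_start t -> Q t (w0 (n := n) t)).

Hypothesis filler : forall U, U \in F -> ~~ (U \subset D) -> v \notin U -> q \notin U ->
  forall m (x : omap m N) (rho : omap N m), face_retract (q |: (v |: U)) x rho ->
  forall w : forall n, omap n N -> Y n,
  natural_on (X := Delta m) (fun n t => horn m (rho v) n t) (fun n t => w n (ocomp x t)) ->
  (forall n (t : omap n m), horn m (rho v) n t -> Q (ocomp x t) (w n (ocomp x t))) ->
  (forall n (t : omap n N), pair_start t -> w n t = w0 t) ->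
  exists y : Y m, Q x y /\
    forall n (t : omap n m), horn m (rho v) n t -> act t y = w n (ocomp x t).

Lemma pair_dom_closed (G : {set {set 'I_N.+1}}) :
  (forall U U' : {set 'I_N.+1}, U' \subset U -> U \in G -> U' \in G) ->
  act_closed (X := Delta N) (pair_dom G).
Proof.
move=> dcG m n a t [tF tG]; have sub := core_act v q t a.
split; first exact: dcF sub tF.
case/or3P: tG => [qt|tD|tG]; apply/or3P.
- by constructor 1; apply: contra qt; apply/subsetP/vertex_set_ocomp.
- by constructor 2; apply: subset_trans sub tD.
- by constructor 3; apply: dcG sub tG.
Qed.

(** When the pair of U is reached, what is known of the face U + v + q is exactly
    its horn at v. *)
Lemma horn_pair_dom (U : {set 'I_N.+1}) (G : {set {set 'I_N.+1}}) m
    (x : omap m N) (rho : omap N m) n (t : omap n m) :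
  U \in F -> ~~ (U \subset D) -> v \notin U -> q \notin U ->
  (forall V : {set 'I_N.+1}, V \proper U -> V \in G) -> U \notin G ->
  face_retract (q |: (v |: U)) x rho ->
  pair_dom G (ocomp x t) <-> horn m (rho v) n t.
Proof.
move=> UF UD vU qU UG UnG fr; have [rx xS xr] := fr.
have vS : v \in q |: (v |: U) by rewrite !inE eqxx orbT.
have coreU : core v q (ocomp x t) \subset U.
  apply/subsetP => l; rewrite !inE => /and3P[lq lv /(subsetP (vertex_set_ocomp _ _))].
  by rewrite (vertex_set_face_retract fr) !inE (negPf lq) (negPf lv).
have im_x l : (x l \in vertex_set (ocomp x t)) = (l \in vertex_set t).
  apply/imsetP/imsetP => -[i _ il]; exists i => //.
    by rewrite -[l]rx il omkE rx.
  by rewrite omkE -il.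
split=> [[tF tG]|/hornP[l lv lt]].
  apply/hornP.
  have [sUt|] := boolP (q |: U \subset vertex_set (ocomp x t)).
    have qt : q \in vertex_set (ocomp x t) by apply: (subsetP sUt); rewrite !inE eqxx.
    have Ut : core v q (ocomp x t) = U.
      apply/eqP; rewrite eqEsubset coreU; apply/subsetP => l lU; rewrite !inE.
      rewrite (subsetP sUt) ?inE ?lU ?orbT // andbT.
      by apply/andP; split; [apply: contraNneq qU|apply: contraNneq vU] => <-.
    by move: tG; rewrite qt Ut (negPf UD) (negPf UnG).
  case/subsetPn => l lqU lt.
  have lS : l \in q |: (v |: U).
    by move: lqU; rewrite !inE => /orP[->|->]; rewrite ?orbT.
  exists (rho l); last by rewrite -im_x xr.
  apply: contraNneq vU => /(congr1 x); rewrite !xr // => lv.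
  by move: lqU; rewrite lv !inE (negPf vq).
split; first exact: dcF coreU UF.
have [qt|] /= := boolP (q \in _); last by [].
apply/orP; right; apply: UG; rewrite properE coreU; apply/subsetPn; exists (x l); last first.
  by rewrite !inE im_x (negPf lt) !andbF.
move: (xS l); rewrite !inE => /or3P[/eqP xq|/eqP xv|//].
  by move: qt; rewrite -xq im_x (negPf lt).
by move: lv; rewrite -xv rx eqxx.
Qed.

(** Induction on the number of sets already treated; the set removed from G has
    maximal size, so that the others still form a down-closed family. *)
Lemma pair_fill_sub c : forall G : {set {set 'I_N.+1}}, #|G| = c -> G \subset F ->
  (forall U U' : {set 'I_N.+1}, U' \subset U -> U \in G -> U' \in G) ->
  exists w : forall n, omap n N -> Y n,
    [/\ natural_on (X := Delta N) (pair_dom G) w,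
        forall n t, pair_dom G t -> Q t (w n t) &
        forall n t, pair_start t -> w n t = w0 t].
Proof.
elim: c => [|c IH] G cG GF dcG.
  have eqA n (t : omap n N) : pair_dom G t -> pair_start t.
    by case=> tF; rewrite (cards0_eq cG) inE orbF.
  by exists (@w0); split=> [m n a t /eqA|n t /eqA|//]; [apply: natw0|apply: Qw0].
have [U0 U0G] : exists U, U \in G by apply/card_gt0P; rewrite cG.
case: (arg_maxnP (fun U : {set 'I_N.+1} => #|U|) U0G) => U UG0 maxU; have {UG0}UG : U \in G := UG0.
have subG V : V \in G :\ U -> V \in G by rewrite inE => /andP[].
have dcG' (V V' : {set 'I_N.+1}) : V' \subset V -> V \in G :\ U -> V' \in G :\ U.
  rewrite !inE => sV /andP[VU VG]; rewrite (dcG _ _ sV VG) andbT.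
  apply: contraNneq VU => VU; by rewrite eq_sym eqEcard (maxU V VG : #|V| <= #|U|) andbT -VU.
have [||//|w [natw Qw ww0]] := IH (G :\ U).
- by apply/eqP; rewrite -eqSS -cG (cardsD1 U G) UG.
- by apply/subsetP => V /subG; apply/subsetP.
have [bad|] := boolP [|| U \subset D, v \in U | q \in U].
  have eqA n (t : omap n N) : pair_dom G t -> pair_dom (G :\ U) t.
    case=> tF tG; split=> //; case/or3P: tG => [->//|->|tG]; first by rewrite orbT.
    rewrite in_setD1 tG andbT; have [tU|] := eqVneq; last by rewrite !orbT.
    case/or3P: bad; rewrite -tU; first by move=> ->; rewrite orbT.
      by rewrite !inE eqxx /= andbF.
    by rewrite !inE eqxx.
  by exists w; split=> // [m n a t /eqA|n t /eqA]; [apply: natw|apply: Qw].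
rewrite !negb_or => /and3P[UD vU qU].
have qS : q \in q |: (v |: U) by rewrite !inE eqxx.
have [m [x [rho fr]]] := face_retract_exists qS.
have UF : U \in F by apply: (subsetP GF).
have hornE n (t : omap n m) := @horn_pair_dom U (G :\ U) m x rho n t UF UD vU qU.
have {}hornE n (t : omap n m) : pair_dom (G :\ U) (ocomp x t) <-> horn m (rho v) n t.
  apply: hornE fr; last by rewrite !inE eqxx.
  move=> V /properP[VU [l lU lV]]; rewrite !inE (dcG _ _ VU UG) andbT.
  by apply: contraNneq lV => ->.
have [||//|y [Qxy yw]] := filler UF UD vU qU fr (w := w).
- by move=> l n a t /hornE ht; rewrite /= -natw //= ocompA.
- by move=> n t /hornE/Qw.
have := @attach (Delta N) Y (pair_dom (G :\ U)) Q w m x y (fun n s => ocomp rho s)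
  (pair_dom_closed dcG') clQ natw Qw.
case=> [l n a s|||r t /hornE/yw //|w' [natw' Qw' w'w]].
- by rewrite /= ocompA.
- by apply: omapP => i; rewrite !omkE; case: fr.
- by [].
have cov n (t : omap n N) : pair_dom G t ->
    pair_dom (G :\ U) t \/ ocomp x (ocomp rho t) = t.
  case=> tF tG.
  have [tU|tU] := eqVneq (core v q t) U; [right|left].
    apply: omapP => i; rewrite !omkE; case: fr => _ _ -> //.
    rewrite -tU !inE mem_vertex_set andbT; case: eqP => //= _; case: eqP => //.
  by split=> //; rewrite in_setD1 tU.
exists w'; split=> [l n a t /cov|n t /cov|n t ts]; [exact: natw'|exact: Qw'|].
rewrite w'w ?ww0 //; case: ts => tF ts; split=> //.
by case/orP: ts => ->; rewrite ?orbT.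
Qed.

Lemma pair_fill : exists w : forall n, omap n N -> Y n,
  [/\ natural_on (X := Delta N) (fun n t => core v q t \in F) w,
      forall n (t : omap n N), core v q t \in F -> Q t (w n t) &
      forall n t, pair_start t -> w n t = w0 t].
Proof.
have [w [natw Qw ww0]] := @pair_fill_sub #|F| F erefl (subxx F) dcF.
have eqA n (t : omap n N) : core v q t \in F -> pair_dom F t by move=> tF; split; rewrite ?tF ?orbT.
by exists w; split=> // [m n a t /eqA|n t /eqA]; [apply: natw|apply: Qw].
Qed.
End PairFill.

(** * Inserting a composite vertex in the base *)
Definition tri0 : 'I_3 := @Ordinal 3 0 isT.
Definition tri1 : 'I_3 := @Ordinal 3 1 isT.
Definition tri2 : 'I_3 := @Ordinal 3 2 isT.
Definition edge0 : 'I_2 := @Ordinal 2 0 isT.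
Definition edge1 : 'I_2 := @Ordinal 2 1 isT.

Lemma vertices2E k (t : omap 2 k) : vertices t = [:: val (t tri0); val (t tri1); val (t tri2)].
Proof.
rewrite /vertices !enum_ordSl enum_ord0 /=.
congr [:: _; _; _]; congr (val (t _)); exact: val_inj.
Qed.

Lemma vertices1E k (t : omap 1 k) : vertices t = [:: val (t edge0); val (t edge1)].
Proof.
rewrite /vertices !enum_ordSl enum_ord0 /=.
congr [:: _; _]; congr (val (t _)); exact: val_inj.
Qed.

Lemma codegE n (i : 'I_n.+1) j : codeg i j = unbump i j :> nat.
Proof. by rewrite omkE. Qed.

Definition composite_tri N (i j : nat) (t : omap 2 N) : Prop :=
  [/\ t tri0 < i, t tri1 = i :> nat & t tri2 = j :> nat].

(** Let b be an m-simplex, with m = p + 2.  The vertices of Delta^(m+1) are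
    0, ..., m - 2, then a, q and z: the first vertex of the last edge of b, the
    composite vertex to be inserted, and the last vertex of b. *)
Section BaseExtension.
Variables (B : scsSet) (hB : infty_bicategory B) (p : nat) (b : B p.+2).

Let a : 'I_p.+4 := inord p.+1.
Let q : 'I_p.+4 := inord p.+2.
Let z : 'I_p.+4 := ord_max.

Let aE : a = p.+1 :> nat. Proof. by apply: inordK; lia. Qed.
Let qE : q = p.+2 :> nat. Proof. by apply: inordK; lia. Qed.
Let zE : z = p.+3 :> nat. Proof. by []. Qed.

(** Sends both q and z to the last vertex of b. *)
Definition collapse_last : omap p.+3 p.+2 := codeg ord_max.
#[global] Arguments collapse_last : simpl never.

Let Q n (t : omap n p.+3) (y : B n) : Prop :=
  forall u : omap 2 n, composite_tri a q (ocomp t u) -> thin (act u y).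

(** All horns at a are inner; their middle triangle (i, a, q), with i the
    largest vertex before a, is made thin when it first appears, in the horn for
    U = {i}. *)
Lemma composite_filler (U : {set 'I_p.+4}) : ~~ (U \subset [set z]) -> a \notin U -> q \notin U ->
  forall m (x : omap m p.+3) (rho : omap p.+3 m), face_retract (q |: (a |: U)) x rho ->
  forall w : forall n, omap n p.+3 -> B n,
  natural_on (X := Delta m) (fun n t => horn m (rho a) n t) (fun n t => w n (ocomp x t)) ->
  (forall n (t : omap n m), horn m (rho a) n t -> Q (ocomp x t) (w n (ocomp x t))) ->
  exists y : B m, Q x y /\
    forall n (t : omap n m), horn m (rho a) n t -> act t y = w n (ocomp x t).
Proof.
move=> UD aU qU m x rho fr w natw Qw; have [rx xS xr] := fr.
have aS : a \in q |: (a |: U) by rewrite !inE eqxx orbT.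
have qS : q \in q |: (a |: U) by rewrite !inE eqxx.
have [i iU ia] : exists2 i, i \in U & i < a.
  case/subsetPn: UD => i iU; rewrite inE => iz; exists i => //.
  have ia : i != a by apply: contraNneq aU => <-.
  have iq : i != q by apply: contraNneq qU => <-.
  move: ia iq iz (ltn_ord i); rewrite -!val_eqE /= !inordK //; lia.
have iS : i \in q |: (a |: U) by rewrite !inE iU !orbT.
have lt_ia := face_retract_lt fr iS aS ia.
have rq : rho q = (rho a).+1 :> nat.
  by apply: (face_retract_succ fr aS qS); [rewrite aE qE | move=> s _; rewrite aE qE].
have lt_qm : rho q < m.+1 := ltn_ord _.
have triP (u : omap 2 m) : composite_tri a q (ocomp x u) <->
    [/\ u tri0 < rho a, u tri1 = rho a & u tri2 = rho q].
  rewrite /composite_tri !omkE; split=> [[u0 /val_inj u1 /val_inj u2]|[u0 -> ->]].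
    split; [|by rewrite -u1 rx|by rewrite -u2 rx].
    by rewrite -(rx (u tri0)); apply: (face_retract_lt fr).
  rewrite !xr //; split=> //.
  rewrite ltnNge; apply/negP => /(omap_leq rho); rewrite rx; lia.
have thw (t : omap 2 m) : composite_tri a q (ocomp x t) -> horn m (rho a) 2 t ->
    thin (w 2 (ocomp x t)).
  by move=> tt /Qw/(_ (oid 2)); rewrite act_id Delta_id; apply.
have vert (t : omap 2 m) : vertices t = [:: (rho a).-1; nat_of_ord (rho a); (rho a).+1] <->
    [/\ t tri0 = (rho a).-1 :> nat, t tri1 = rho a & t tri2 = rho q].
  rewrite vertices2E -rq; split=> [[/= -> /val_inj -> /val_inj ->] //|[/= -> -> -> //]].
have ra : 0 < rho a < m by lia.
have [|y [yw yth]] := inner_horn_extension hB ra natw.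
  move=> t /vert[t0 t1 t2]; apply: thw; apply/triP; split=> //; lia.
exists y; split=> // u /[dup] cu /triP[u0 u1 u2].
(* If the first vertex of u is not the largest one before a, then u lies in the horn,
   where it is known to be thin. *)
have [u0E|u0E] := eqVneq (val (u tri0)) (rho a).-1; first by apply/yth/vert.
have hm : (rho a).-1 < m.+1 by lia.
have hu : horn m (rho a) 2 u.
  apply/hornP; exists (Ordinal hm); first by rewrite -val_eqE /=; lia.
  apply/imsetP => -[l _ /(congr1 val) /= lE].
  have : l = tri0 \/ tri1 <= l.
    by case: l {lE} => -[|l] Hl; [left; apply: val_inj|right].
  case=> [lu|/(omap_leq u)]; first by move: u0E; rewrite lE lu eqxx.
  rewrite u1 -lE; lia.
by rewrite yw //; apply: thw.
Qed.

(** T starts from the degeneracy of b that repeats its last vertex, which is kept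
    on the faces without q and on the triangle a, q, z; every other simplex through
    q is chosen anew, so as to make the triangles (i, a, q) thin. *)
Lemma composite_exists : exists T : B p.+3,
  (forall r (t : omap r p.+3), (q \notin vertex_set t) || (core a q t \subset [set z]) ->
     act t T = act (ocomp collapse_last t) b) /\
  (forall t : omap 2 p.+3, composite_tri p.+1 p.+2 t -> thin (act t T)).
Proof.
have clQ : act_closed2 (X := Delta p.+3) Q.
  by move=> m n u t y Qty v /=; rewrite -ocompA -act_comp; apply: Qty.
have aq : a != q by rewrite -val_eqE /= aE qE neq_ltn ltnSn.
have [||||w [natw Qw ww0]] := @pair_fill B p.+3 a q setT [set z] Q
  (fun n t => act (ocomp collapse_last t) b) aq _ clQ.
- by move=> *; rewrite inE.
- by move=> m n u t _ /=; rewrite ocompA act_comp.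
- move=> n t [_ ts] u [u0 u1 u2].
  have qt : q \in vertex_set t.
    have -> : q = t (u tri2) by apply: val_inj; rewrite /= -u2 omkE.
    exact: mem_vertex_set.
  move: ts; rewrite qt /= => /subsetP/(_ (t (u tri0))).
  have tu : t (u tri0) < a by move: u0; rewrite omkE.
  have -> : t (u tri0) \in core a q t.
    rewrite !inE mem_vertex_set andbT -!val_eqE /=; move: aE qE; lia.
  rewrite inE -val_eqE /= => /(_ isT) /eqP; move: aE zE; lia.
- move=> U _ UD aU qU m x rho fr w natw Qw ww0; exact: (composite_filler UD aU qU fr natw Qw).
exists (w p.+3 (oid p.+3)); split=> [r t ts|t tt].
  by rewrite -natw ?inE //= Delta_idl ww0 //; split; rewrite ?inE.
have /Qw/(_ t) : core a q (oid p.+3) \in setT by rewrite inE.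
by apply; rewrite Delta_idl; case: tt => t0 t1 t2; split; rewrite ?aE ?qE.
Qed.
End BaseExtension.

(** * Cartesian edges lift horns without thinness conditions *)
Lemma collapse_lastE p (i : 'I_p.+4) : collapse_last p i = minn i p.+2 :> nat.
Proof. by rewrite codegE /= /unbump; have := ltn_ord i; lia. Qed.

Lemma osegE n (i : 'I_n.+1) j : oseg i j = i + j :> nat.
Proof. by rewrite omkE. Qed.

Section CartesianLift.
Variables (E B : scsSet) (f : scmap E B) (hf : outer_fibration f) (hB : infty_bicategory B).
Variables (p : nat) (b : B p.+2) (w : forall r, omap r p.+2 -> E r) (e : E 1).
Hypothesis natw : natural_on (X := Delta p.+2) (fun r t => horn p.+2 p.+2 r t) w.
Hypothesis overw : forall r (t : omap r p.+2), horn p.+2 p.+2 r t -> f r (w t) = act t b.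
Hypotheses (ce : cartesian_edge f e)
  (we : forall t : omap 1 p.+2, vertices t = [:: p.+1; p.+2] -> w t = e).

Let a : 'I_p.+4 := inord p.+1.
Let q : 'I_p.+4 := inord p.+2.
Let z : 'I_p.+4 := ord_max.
Let aE : a = p.+1 :> nat. Proof. by apply: inordK; lia. Qed.
Let qE : q = p.+2 :> nat. Proof. by apply: inordK; lia. Qed.
Let zE : z = p.+3 :> nat. Proof. by []. Qed.

Local Notation kap := (collapse_last p).

(** The faces of Delta^(m+1) not containing the whole front 0, ..., m - 1: they
   restrict to the horn of b. *)
Let F : {set {set 'I_p.+4}} :=
  [set U : {set 'I_p.+4} | ~~ ([set i : 'I_p.+4 | i < p.+2] \subset U)].

Lemma last_hornP n (t : omap n p.+2) :
  horn p.+2 p.+2 n t <-> exists2 j : 'I_p.+3, j < p.+2 & j \notin vertex_set t.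
Proof.
split=> [/(@hornP _ ord_max)|] [j jm jt].
  exists j => //; move: jm (ltn_ord j); rewrite -val_eqE /=; lia.
by apply/(@hornP _ ord_max); exists j => //; rewrite -val_eqE /=; lia.
Qed.

Lemma missing_front n (t : omap n p.+3) :
  core z q t \in F <-> exists2 j : 'I_p.+4, j < p.+2 & j \notin vertex_set t.
Proof.
rewrite inE; split=> [/subsetPn[j]|[j jp jt]].
  rewrite !inE => jp jt; exists j => //; apply: contra jt => ->.
  rewrite andbT -!val_eqE /=; move: qE; lia.
by apply/subsetPn; exists j; rewrite !inE // (negPf jt) !andbF.
Qed.

Lemma missing_horn n (t : omap n p.+3) : core z q t \in F -> horn p.+2 p.+2 n (ocomp kap t).
Proof.
case/missing_front => j jp jt; apply/last_hornP; have jp' : j < p.+3 by lia.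
exists (Ordinal jp') => //; apply: contra jt => /imsetP[i _ /(congr1 val)].
rewrite ocompE /= collapse_lastE => jE.
have -> : j = t i by apply: val_inj => /=; lia.
exact: mem_vertex_set.
Qed.

Let start n (t : omap n p.+3) := pair_start z q F [set a] t.

Lemma start_base n (t : omap n p.+3) :
  start t -> (q \notin vertex_set t) || (core a q t \subset [set z]).
Proof.
case=> _ /orP[->//|/subsetP tD]; apply/orP; right; apply/subsetP => i.
rewrite !inE => /and3P[iq ia it]; apply: contraNT ia => iz.
by have := tD i; rewrite !inE iq iz it => /(_ isT).
Qed.

Lemma start_val n (t : omap n p.+3) : (forall i, p.+1 <= t i) -> start t.
Proof.
move=> pt; split.
  apply/missing_front; exists ord0 => //; apply/imsetP => -[i _ /(congr1 val)] /=.
  by have := pt i; case: (nat_of_ord _).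
apply/orP; right; apply/subsetP => i; rewrite !inE => /and3P[iq iz /imsetP[j _ ij]].
move: iq iz (pt j) (ltn_ord i); rewrite -ij -!val_eqE /=; move: aE qE; lia.
Qed.

Section Base.
Variable T : B p.+3.
Hypothesis TE : forall r (t : omap r p.+3),
  (q \notin vertex_set t) || (core a q t \subset [set z]) ->
     act t T = act (ocomp kap t) b.

(** The faces U + q + z are filled along the horns opposite z, whose last edge
    q -> z is degenerate.  Only U with a vertex before a needs this, so these horns
    have dimension at least 2. *)
Lemma lift_off_composite : exists w1 : forall n, omap n p.+3 -> E n,
  [/\ natural_on (X := Delta p.+3) (fun n t => core z q t \in F) w1,
      forall n (t : omap n p.+3), core z q t \in F -> f n (w1 n t) = act t T &
      forall n (t : omap n p.+3), start t -> w1 n t = w (ocomp kap t)].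
Proof.
apply: (@pair_fill E p.+3 z q F [set a] (fun n t y => f n y = act t T)
  (fun n t => w (ocomp kap t))).
- rewrite -val_eqE /=; move: qE; lia.
- by move=> U U' UU; rewrite !inE; apply: contra => /subset_trans; apply.
- by move=> m n u t y ty; rewrite smap_act ty /= act_comp.
- by move=> m n u t [tF _] /=; rewrite ocompA natw //; apply: missing_horn.
- by move=> n t st; rewrite TE ?start_base // overw //; apply: missing_horn; case: st.
move=> U UF UD zU qU m x rho fr w1 natw1 Qw1 ww1; have [rx xS xr] := fr.
have zS : z \in q |: (z |: U) by rewrite !inE eqxx orbT.
have qS : q \in q |: (z |: U) by rewrite !inE eqxx.
have rz : rho z = m :> nat.
  have : rho (x ord_max) <= rho z by apply: omap_leq; rewrite zE -ltnS ltn_ord.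
  move: (ltn_ord (rho z)); rewrite rx /=; lia.
have rq : rho z = (rho q).+1 :> nat.
  apply: (face_retract_succ fr) => //; first by rewrite qE.
  by move=> s _; rewrite qE zE.
(* Besides q and z the face has a vertex in U, so its dimension is at least 2. *)
have [i iU iq] : exists2 i, i \in U & i < q.
  case/subsetPn: UD => i iU _; exists i => //.
  have iz : i != z by apply: contraNneq zU => <-.
  have iq : i != q by apply: contraNneq qU => <-.
  move: iz iq (ltn_ord i); rewrite -!val_eqE /=; move: qE; lia.
have iS : i \in q |: (z |: U) by rewrite !inE iU !orbT.
have := face_retract_lt fr iS qS iq => lt_iq.
move: natw1 Qw1; rewrite rz => natw1 Qw1.
have m2 : 1 < m.
  by apply: (@leq_trans (rho z)); [rewrite rq ltnS (leq_ltn_trans _ lt_iq) | rewrite rz].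
have rqm : rho q = m.-1 :> nat by apply: succn_inj; rewrite -rq rz prednK // ltnW.
have x_top (l : 'I_m.+1) : val l \in [:: m.-1; m] -> p.+2 <= x l.
  rewrite !inE => /orP[] /eqP /= lm.
    by have -> : l = rho q; [apply: ord_inj; rewrite lm rqm | rewrite xr // qE].
  by have -> : l = rho z; [apply: ord_inj; rewrite lm rz | rewrite xr // zE].
have [n t ht|n t /forallP tf|y [yT yw]] := collapsed_horn_lift hf (b := act x T)
  (z := w (oconst 0 (ord_max : 'I_p.+3))) m2 natw1.
- by rewrite Qw1 //= act_comp.
- rewrite ww1; last by apply: start_val => j; rewrite ocompE ltnW // x_top.
  rewrite -natw.
    congr w; apply: omapP => j; rewrite !ocompE [RHS]omkE; apply: val_inj.
    by rewrite /= collapse_lastE; apply/minn_idPr/x_top.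
  by apply/last_hornP; exists ord0 => //; apply/imsetP => -[j _]; rewrite omkE => /(congr1 val).
by exists y.
Qed.

Hypothesis thT : forall t : omap 2 p.+3, composite_tri p.+1 p.+2 t -> thin (act t T).

Definition initial_face : omap p.+2 p.+3 :=
  @omk p.+2 p.+3 (fun i => widen_ord (leqnSn _) i) (fun i j ij => ij).

Lemma initial_faceE i : initial_face i = i :> nat.
Proof. by rewrite omkE. Qed.

Lemma initial_faceK : ocomp kap initial_face = oid p.+2.
Proof.
apply: omapP => i; rewrite ocompE [RHS]omkE; apply: val_inj => /=.
by rewrite collapse_lastE initial_faceE; apply/minn_idPl; rewrite -ltnS.
Qed.

Lemma missing_initial n (t : omap n p.+2) :
  core z q (ocomp initial_face t) \in F <-> horn p.+2 p.+2 n t.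
Proof.
rewrite -[t in X in _ <-> X]Delta_idl -initial_faceK -ocompA.
split=> [|/last_hornP[j jp jt]]; first exact: missing_horn.
apply/missing_front; exists (widen_ord (leqnSn _) j) => //; apply: contra jt => /imsetP[i _].
move=> /(congr1 val); rewrite !ocompE /= => ji; apply/imsetP; exists i => //.
by rewrite !ocompE; apply: val_inj; rewrite /= collapse_lastE -ji; apply/esym/minn_idPl/ltnW.
Qed.

(** The face opposite z is a horn whose last edge is e and whose triangle
    (0, a, q) is thin by the choice of T. *)
Lemma lift_composite_face : exists w2 : forall n, omap n p.+3 -> E n,
  [/\ natural_on (X := Delta p.+3) (fun n t => horn p.+3 p.+2 n t) w2,
      forall n (t : omap n p.+3), horn p.+3 p.+2 n t -> f n (w2 n t) = act t T &
      forall n (t : omap n p.+3), start t -> w2 n t = w (ocomp kap t)].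
Proof.
have [w1 [natw1 Qw1 ww1]] := lift_off_composite.
pose w1' n (t : omap n p.+2) := w1 n (ocomp initial_face t).
have natw1' : natural_on (X := Delta p.+2) (fun r t => horn p.+2 p.+2 r t) w1'.
  by move=> m n u t /missing_initial ht; rewrite /w1' -natw1 //= ocompA.
have [//||||y [yT yw]] := thin_cartesian_horn_lift (b := act initial_face T) hf _ natw1' _ _ ce.
- by move=> n t /missing_initial/Qw1 ->; rewrite /= act_comp.
- move=> t; rewrite vertices2E -act_comp => -[t0 t1 t2]; apply: thT.
  by split; rewrite ocompE initial_faceE ?t0 ?t1 ?t2.
- move=> t vt; rewrite /w1' ww1; first by rewrite ocompA initial_faceK Delta_idl we.
  apply: start_val => i; rewrite ocompE initial_faceE.
  move: vt; rewrite vertices1E => -[t0 _].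
  by have := omap_leq t (leq0n i : edge0 <= i); rewrite [X in X <= _ -> _]t0.
have := @attach (Delta p.+3) E (fun n t => core z q t \in F) (fun n t y => f n y = act t T)
  w1 p.+2 initial_face y (fun n t => ocomp kap t).
case.
- move=> m n u t /missing_front[j jp jt]; apply/missing_front; exists j => //; apply: contra jt.
  exact/subsetP/vertex_set_ocomp.
- by move=> m n u t y' ty; rewrite smap_act ty /= act_comp.
- exact: natw1.
- exact: Qw1.
- by move=> l n u t; rewrite /= ocompA.
- exact: initial_faceK.
- exact: yT.
- by move=> r t /missing_initial/yw.
move=> w2 [natw2 Qw2 w2w].
have cov n (t : omap n p.+3) : horn p.+3 p.+2 n t ->
    core z q t \in F \/ ocomp initial_face (ocomp kap t) = t.
  have -> : horn p.+3 p.+2 n t = horn p.+3 q n t by rewrite qE.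
  case/hornP => j jq jt.
  have [jp|jp] := ltnP j p.+2; first by left; apply/missing_front; exists j.
  have jz : j = z.
    apply: val_inj; move: jq (ltn_ord j); rewrite -val_eqE /=; move: qE; lia.
  right; apply: omapP => i; rewrite !ocompE; apply: val_inj.
  rewrite /= initial_faceE collapse_lastE.
  have : t i != z by apply: contraNneq jt => tz; rewrite jz -tz mem_vertex_set.
  by rewrite -val_eqE /=; have := ltn_ord (t i); lia.
exists w2; split=> [m n u t /cov|n t /cov|n t [tF ts]]; [exact: natw2|exact: Qw2|].
by rewrite w2w ?ww1.
Qed.
End Base.

Lemma omit_mono (i j : 'I_p.+3) : i <= j -> lift q i <= lift q j.
Proof. by rewrite /= leq_bump2. Qed.

Definition omit_composite : omap p.+2 p.+3 := omk omit_mono.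

Lemma omit_compositeE i : omit_composite i = lift q i.
Proof. exact: omkE. Qed.

Lemma omit_compositeK : ocomp kap omit_composite = oid p.+2.
Proof.
apply: omapP => i; rewrite ocompE [RHS]omkE omit_compositeE; apply: val_inj => /=.
rewrite collapse_lastE /= /bump qE; have := ltn_ord i; lia.
Qed.

(** The triangle (a, q, z) of T is degenerate, so the horn at q lifts to all of T,
    and the face opposite q lies over b. *)
Lemma cartesian_horn_lift_dim :
  exists y : E p.+2, f _ y = b /\ forall r (t : omap r p.+2), horn p.+2 p.+2 r t -> act t y = w t.
Proof.
have [T [TE thT]] := composite_exists hB b.
have [w2 [natw2 Qw2 ww2]] := lift_composite_face TE thT.
have [//||Y [YT Yw]] := inner_horn_lift hf natw2 Qw2.
- by rewrite /= ltnSn.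
- move=> t; rewrite vertices2E => -[t0 t1 t2]; rewrite TE; last first.
    apply: start_base; apply: start_val => i.
    by have := omap_leq t (leq0n i : tri0 <= i); rewrite [X in X <= _ -> _]t0.
  apply: thin_degenerate; exists edge1, (act (ocomp (ocomp kap t) (oseg ord0)) b).
  rewrite -act_comp; congr act; apply: omapP => i; rewrite !ocompE; apply: val_inj.
  rewrite /= !collapse_lastE.
  have [i2|i2] := eqVneq i tri2.
    have -> : oseg ord0 (codeg edge1 i) = tri1 by apply: ord_inj; rewrite osegE codegE i2.
    by rewrite i2; move: t1 t2 => /= -> ->; lia.
  suff -> : oseg ord0 (codeg edge1 i) = i by [].
  apply: ord_inj; rewrite osegE codegE /= /unbump.
  by case: i i2 => -[|[|[]]].
exists (act omit_composite Y); split=> [|r t ht].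
  rewrite smap_act YT TE -?act_comp; last first.
    apply/orP; left; apply/imsetP => -[i _]; rewrite omit_compositeE => /eqP.
    by rewrite (negPf (neq_lift _ _)).
  by rewrite omit_compositeK act_id.
have Fst : start (ocomp omit_composite t).
  split.
    case/last_hornP: ht => j jp jt; apply/missing_front; exists (lift q j).
      by rewrite /= /bump qE; lia.
    apply: contra jt => /imsetP[i _]; rewrite ocompE omit_compositeE => /lift_inj ->.
    exact: mem_vertex_set.
  apply/orP; left; apply/imsetP => -[i _]; rewrite ocompE omit_compositeE => /eqP.
  by rewrite (negPf (neq_lift _ _)).
rewrite -act_comp Yw ?ww2 // ?ocompA ?omit_compositeK ?Delta_idl //.
case: Fst => /missing_front[j jp jt] _.
suff: horn p.+3 q r (ocomp omit_composite t) by rewrite qE.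
by apply/hornP; exists j => //; rewrite -val_eqE /= qE neq_ltn jp.
Qed.
End CartesianLift.

Lemma cartesian_horn_lift (E B : scsSet) (f : scmap E B) (hf : outer_fibration f)
    (hB : infty_bicategory B) k (b : B k) (w : forall r, omap r k -> E r) (e : E 1) :
  2 <= k -> natural_on (X := Delta k) (fun r t => horn k k r t) w ->
  (forall r (t : omap r k), horn k k r t -> f r (w r t) = act t b) ->
  cartesian_edge f e -> (forall t : omap 1 k, vertices t = [:: k.-1; k] -> w 1 t = e) ->
  exists y : E k, f k y = b /\ forall r (t : omap r k), horn k k r t -> act t y = w r t.
Proof.
case: k b w => [|[|p]] // b w _ natw overw ce we.
exact: (cartesian_horn_lift_dim hf hB natw overw ce we).
Qed.

(** * Cylinders over a simplex *)
Lemma rank_leq i s s' t t' : s <= s' -> t <= t' ->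
  (if s == 0 then minn t i else (maxn t i).+1) <= (if s' == 0 then minn t' i else (maxn t' i).+1).
Proof. case: eqP => [->|]; case: eqP => [->|]; lia. Qed.

Lemma I2_neq0 (x : 'I_2) : x != ord0 -> x = ord_max.
Proof. by case: x => -[|[|]] // Hx _; apply: ord_inj. Qed.

Section Prism.
Variable n : nat.
Local Notation prism := (sprod (Delta 1) (Delta n)).
Implicit Types (i : 'I_n.+1).

Lemma chain_time_mono i (l l' : 'I_n.+2) :
  l <= l' ->
  (if l <= i then ord0 : 'I_2 else ord_max) <= (if l' <= i then ord0 : 'I_2 else ord_max).
Proof. by move=> ll; case: (leqP l' i) => [/(leq_trans ll) ->|_] //; case: ifP. Qed.

Definition chain_time i : omap n.+1 1 := omk (@chain_time_mono i).

Definition chain i : prism n.+1 := (chain_time i : Delta 1 n.+1, codeg i : Delta n n.+1).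

(** The retraction moves (0,t) down to (0, min t i) and (1,t) up to (1, max t i). *)
Lemma chain_rank_subproof i (s : 'I_2) (t : 'I_n.+1) :
  (if s == ord0 then minn t i else (maxn t i).+1) < n.+2.
Proof. by have := ltn_ord t; have := ltn_ord i; case: ifP => _; lia. Qed.

Definition chain_rank i r (p : prism r) (l : 'I_r.+1) : 'I_n.+2 :=
  Ordinal (chain_rank_subproof i (p.1 l) (p.2 l)).

Lemma chain_rank_mono i r (p : prism r) (l l' : 'I_r.+1) :
  l <= l' -> chain_rank i p l <= chain_rank i p l'.
Proof.
move=> ll; exact: (@rank_leq i _ _ _ _ (omap_leq p.1 ll) (omap_leq p.2 ll)).
Qed.

Definition chain_retract i r (p : prism r) : omap r n.+1 := omk (@chain_rank_mono i r p).

Lemma chain_retractE i r (p : prism r) l :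
  chain_retract i p l = (if p.1 l == ord0 then minn (p.2 l) i else (maxn (p.2 l) i).+1) :> nat.
Proof. by rewrite omkE. Qed.

Lemma chain_timeE i l : chain_time i l = if l <= i then ord0 else ord_max.
Proof. exact: omkE. Qed.

Lemma chain_retract_act i l r (a : omap l r) (p : prism r) :
  chain_retract i (act a p) = ocomp (chain_retract i p) a.
Proof.
by apply: omapP => j; apply: ord_inj; rewrite ocompE !chain_retractE /= !ocompE.
Qed.

Lemma chain_retractK i : chain_retract i (chain i) = oid n.+1.
Proof.
apply: omapP => j; apply: ord_inj.
rewrite chain_retractE chain_timeE codegE [RHS](congr1 val (omkE _ _)).
by rewrite /= /unbump; case: leqP => /=; lia.
Qed.

Definition on_chain i r (p : prism r) : Prop :=
  forall l, if p.1 l == ord0 then p.2 l <= i else i <= p.2 l.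

Lemma on_chain_retract i r (p : prism r) : on_chain i p <-> act (chain_retract i p) (chain i) = p.
Proof.
case: p => s t; split=> [ch|pE l].
  have e1 : ocomp (chain_time i) (chain_retract i (s, t)) = s.
    apply: omapP => l; rewrite ocompE chain_timeE chain_retractE /=.
    have [->|/I2_neq0 ->] := eqVneq (s l) ord0; first by rewrite geq_minr.
    by rewrite ltnNge leq_maxr.
  have e2 : ocomp (codeg i) (chain_retract i (s, t)) = t.
    apply: omapP => l; apply: ord_inj; move: (ch l).
    rewrite ocompE codegE chain_retractE /= /unbump.
    by case: ifP => _ chl; lia.
  by rewrite /= /prod_act /= e1 e2.
have e1 : ocomp (chain_time i) (chain_retract i (s, t)) l = s l.
  by congr (omap_fun _ _); apply: (congr1 fst pE).
have e2 : ocomp (codeg i) (chain_retract i (s, t)) l = t l :> nat.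
  by congr (nat_of_ord (omap_fun _ _)); apply: (congr1 snd pE).
move: e1 e2; rewrite !ocompE chain_timeE codegE chain_retractE /= /unbump.
have [->|/I2_neq0 ->] /= := eqVneq (s l) ord0; first by lia.
by case: leqP => /=; lia.
Qed.

Definition prism_start r (p : prism r) : Prop :=
  (forall l, p.1 l = ord_max) \/ vertex_set p.2 != setT.

Definition prism_dom c r (p : prism r) : Prop :=
  prism_start p \/ exists2 i : 'I_n.+1, i < c & on_chain i p.

Lemma prism_dom_closed c : act_closed (X := prism) (prism_dom c).
Proof.
move=> m r a [s t] [[s1|tn]|[i ic ch]].
- by left; left => l /=; rewrite ocompE s1.
- left; right; apply: contra tn => /eqP at_T; rewrite eqEsubset subsetT /= -at_T.
  exact: vertex_set_ocomp.
- by right; exists i => // l /=; rewrite !ocompE; apply: ch.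
Qed.

(** A simplex of the prism that starts in 0 lies on the chain that switches at the
    largest second coordinate reached in 0. *)
Lemma prism_cover r (p : prism r) : prism_dom n.+1 p.
Proof.
have [/existsP[l0 l00]|/existsPn no0] := boolP [exists l, p.1 l == ord0]; last first.
  left; left => l; apply: ord_inj; move: (no0 l) (ltn_ord (p.1 l)); rewrite -val_eqE /=; lia.
right; case: (arg_maxnP (P := fun l => p.1 l == ord0) (fun l => val (p.2 l)) l00) => l /= l0' lmax.
exists (p.2 l) => // l'; case: ifP => [/lmax //|/negP l'1].
apply: omap_leq; rewrite leqNgt; apply/negP => /ltnW/(omap_leq p.1).
have /eqP -> := l0'; rewrite leqn0 => /eqP l'0; apply: l'1; exact/eqP/ord_inj.
Qed.

Lemma chain_fst i r (u : omap r n.+1) l :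
  (act u (chain i)).1 l = if u l <= i then ord0 else ord_max.
Proof. by rewrite -chain_timeE -ocompE. Qed.

Lemma chain_snd i r (u : omap r n.+1) l : (act u (chain i)).2 l = unbump i (u l) :> nat.
Proof. by rewrite -codegE -ocompE. Qed.

(** Once the chains before the i-th are known, so are exactly the faces of the i-th
    chain other than the one opposite (1,i): leaving out (0,i) gives a face of the
    preceding chain, leaving out any other vertex projects to a proper face of
    Delta^n. *)
Lemma chain_horn i r (u : omap r n.+1) :
  prism_dom i (act u (chain i)) <-> horn n.+1 i.+1 r u.
Proof.
have [i1 i1E] : exists i1 : 'I_n.+2, i1 = i.+1 :> nat by exists (lift ord0 i).
have [i0 i0E] : exists i0 : 'I_n.+2, i0 = i :> nat by exists (widen_ord (leqnSn _) i).
have -> : horn n.+1 i.+1 r u = horn n.+1 i1 r u by rewrite i1E.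
have i01 : i0 != i1 by rewrite -val_eqE /= i1E i0E; lia.
split=> [[[s1|]|[j ji ch]]|/hornP[j ji ju]].
- apply/hornP; exists i0 => //; apply/imsetP => -[l _ il].
  by have := s1 l; rewrite chain_fst -il i0E leqnn => /(congr1 val).
- rewrite -subTset => /subsetPn[j _ jt].
  have [j' j'E] : exists j' : 'I_n.+2, j' = (if j <= i then j : nat else j.+1) :> nat.
    by case: ifP => _; [exists (widen_ord (leqnSn _) j)|exists (lift ord0 j)].
  apply/hornP; exists j'; first by rewrite -val_eqE /= j'E i1E; case: leqP; lia.
  apply: contra jt => /imsetP[l _ jl]; apply/imsetP; exists l => //.
  by apply: ord_inj; rewrite chain_snd -jl j'E /unbump; case: (leqP j i) => ?; lia.
- apply/hornP; exists i0 => //; apply/imsetP => -[l _ il].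
  by have := ch l; rewrite chain_fst chain_snd -il i0E leqnn eqxx /unbump; lia.
have [j_i|j_i] := eqVneq j i0.
  have ui l : u l != i :> nat.
    apply: contraNneq ju => ul; rewrite j_i; apply/imsetP; exists l => //.
    by apply: ord_inj; rewrite i0E.
  have [i_0|i_gt0] := posnP i.
    by left; left => l; rewrite chain_fst ifN // -ltnNge; move: (ui l); rewrite i_0 lt0n.
  have hj : i.-1 < n.+1 by have := ltn_ord i; lia.
  right; exists (Ordinal hj) => [|l] /=; first lia.
  by rewrite chain_fst chain_snd /unbump; have := ui l; case: leqP => /=; lia.
left; right; apply/negP => /eqP uT.
have : codeg i j \in vertex_set (act u (chain i)).2 by rewrite uT inE.
case/imsetP => l _ /(congr1 val) /=; rewrite codegE chain_snd /unbump => jl.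
have lj : u l != j by apply: contraNneq ju => <-; apply: mem_vertex_set.
by move: lj j_i ji jl; rewrite -!val_eqE /= i1E i0E; lia.
Qed.
End Prism.

Section PrismFill.
Variables (E B : scsSet) (f : scmap E B) (hf : outer_fibration f) (hB : infty_bicategory B).
Variables (n : nat) (n_gt0 : 0 < n).
Local Notation prism := (sprod (Delta 1) (Delta n)).
Variables (h : smap prism B) (w : forall r, prism r -> E r) (e : E 1).
Hypothesis thin_h : forall (s : omap 2 1) (t : omap 2 n),
  s tri0 = ord0 -> s tri1 = ord_max -> t tri0 = t tri1 -> thin (h 2 (s, t)).
Hypothesis natw : natural_on (X := prism) (@prism_start n) w.
Hypothesis overw : forall r (p : prism r), prism_start p -> f r (w p) = h r p.
Hypotheses (ce : cartesian_edge f e) (we : @w 1 (oid 1, oconst 1 ord_max) = e).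

Lemma prism_fill_chains c : c <= n.+1 -> exists w' : forall r, prism r -> E r,
  [/\ natural_on (X := prism) (fun r p => prism_dom c p) w',
      forall r (p : prism r), prism_dom c p -> f r (w' r p) = h r p &
      forall r (p : prism r), prism_start p -> w' r p = w p].
Proof.
elim: c => [|c IH] cn.
  have eqA r (p : prism r) : prism_dom 0 p -> prism_start p by case=> // -[].
  by exists (@w); split=> // [m r a p /eqA|r p /eqA]; [apply: natw|apply: overw].
have [w1 [natw1 ow1 w1w]] := IH (ltnW cn).
pose i : 'I_n.+1 := Ordinal cn.
have ci : c = i by [].
rewrite ci in natw1 ow1.
pose u1 r (u : omap r n.+1) := w1 r (act u (chain i)).
have natu1 : natural_on (X := Delta n.+1) (fun r u => horn n.+1 i.+1 r u) u1.
  by move=> m r a u /chain_horn hu; rewrite /u1 -natw1 // -act_comp.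
have ou1 r (u : omap r n.+1) : horn n.+1 i.+1 r u -> f r (u1 r u) = act u (h _ (chain i)).
  by move=> /chain_horn hu; rewrite ow1 // smap_act.
have [y [yh yu]] : exists y : E n.+1, f _ y = h _ (chain i) /\
    forall r (u : omap r n.+1), horn n.+1 i.+1 r u -> act u y = u1 r u.
  have [lt_cn|ge_cn] := ltnP c n.
    apply: (inner_horn_lift hf natu1 ou1) => [|t]; first by rewrite /= ltnS.
    rewrite vertices2E => -[t0 t1 t2]; rewrite -smap_act; apply: thin_h.
    - by rewrite ocompE chain_timeE [X in X <= _]t0 leqnn.
    - by rewrite ocompE chain_timeE [X in X <= _]t1 ltnn.
    apply: ord_inj; rewrite !ocompE !codegE /unbump; move: t0 t1 => /= -> ->.
    by rewrite ltnn ltnSn subn0 subn1.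
  have cE : c = n by apply/eqP; rewrite eqn_leq ge_cn -ltnS cn.
  move: natu1 ou1; rewrite /= cE => natu1 ou1.
  apply: (cartesian_horn_lift hf hB _ natu1 ou1 ce) => [//|t]; rewrite vertices1E => -[t0 t1].
  rewrite /u1 w1w; last first.
    right; apply/negP => /eqP tT; have : ord0 \in vertex_set (act t (chain i)).2 by rewrite tT inE.
    case/imsetP => l _ /(congr1 (@nat_of_ord _)); rewrite chain_snd /unbump.
    have := omap_leq t (leq0n l : edge0 <= l); rewrite [X in X <= _ -> _]t0 /= cE; lia.
  rewrite -we; congr (@w 1 (_, _)); apply: omapP => l.
    rewrite ocompE chain_timeE [RHS]omkE /=; case: l => -[|[|//]] l2; apply: ord_inj => /=.
      have -> : Ordinal l2 = edge0 by apply: ord_inj.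
      by rewrite [X in X <= _]t0 cE leqnn.
    have -> : Ordinal l2 = edge1 by apply: ord_inj.
    by rewrite [X in X <= _]t1 cE ltnn.
  apply: ord_inj; rewrite ocompE codegE [RHS](congr1 val (omkE _ _)) /= /unbump.
  case: l => -[|[|//]] l2.
    have -> : Ordinal l2 = edge0 by apply: ord_inj.
    by rewrite [nat_of_ord (t edge0)]t0 cE ltnn subn0.
  have -> : Ordinal l2 = edge1 by apply: ord_inj.
  by rewrite [nat_of_ord (t edge1)]t1 cE ltnSn subn1.
have := @attach prism E (fun r p => prism_dom i p) (fun r p y => f r y = h r p) w1 n.+1
  (chain i) y (@chain_retract n i) (@prism_dom_closed n i).
case.
- by move=> m r a p y' py; rewrite !smap_act py.
- exact: natw1.
- exact: ow1.
- exact: chain_retract_act.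
- exact: chain_retractK.
- exact: yh.
- by move=> r t /chain_horn; apply: yu.
move=> w2 [natw2 ow2 w2w].
have cov r (p : prism r) : prism_dom c.+1 p ->
    prism_dom i p \/ act (chain_retract i p) (chain i) = p.
  case=> [|[j jc ch]]; first by left; left.
  have [jlt|] := ltnP j i; first by left; right; exists j.
  move=> ij; right; apply/on_chain_retract; suff <- : j = i by [].
  by apply: ord_inj; apply/eqP; rewrite eqn_leq ij andbT -ltnS.
exists w2; split=> [m r a p /cov|r p /cov|r p sp]; [exact: natw2|exact: ow2|].
by rewrite w2w ?w1w //; left.
Qed.

Lemma prism_fill : exists w' : forall r, prism r -> E r,
  [/\ forall m r (a : omap m r) (p : prism r), w' m (act a p) = act a (w' r p),
      forall r (p : prism r), f r (w' r p) = h r p &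
      forall r (p : prism r), prism_start p -> w' r p = w p].
Proof.
have [w' [natw' ow' w'w]] := prism_fill_chains (leqnn n.+1).
by exists w'; split=> // [m r a p|r p]; [apply: natw'|apply: ow']; apply: prism_cover.
Qed.
End PrismFill.

(** * Unique presentation of simplices by nondegenerate ones *)
Lemma section_through r n (a : omap r n) (l : 'I_r.+1) : vertex_set a = setT ->
  exists d : omap n r, (forall j, a (d j) = j) /\ d (a l) = l.
Proof.
move=> aT.
have /boolp.choice[d0 d0P] (j : 'I_n.+1) : exists i, a i = j /\ (j = a l -> i = l).
  have [->|jl] := eqVneq j (a l); first by exists l.
  have : j \in vertex_set a by rewrite aT inE.
  by case/imsetP => i _ ji; exists i; split=> // /eqP; rewrite (negPf jl).
have d0_mono (i j : 'I_n.+1) : i <= j -> d0 i <= d0 j.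
  have [[ai _] [aj _]] := (d0P i, d0P j).
  move=> ij; rewrite leqNgt; apply/negP => ji; have := omap_leq a (ltnW ji).
  rewrite ai aj => ji'; move: ji; have -> : i = j by apply/ord_inj/eqP; rewrite eqn_leq ij.
  by rewrite ltnn.
exists (omk d0_mono); split=> [j|]; rewrite omkE; first by case: (d0P j).
by case: (d0P (a l)) => _; apply.
Qed.

Lemma surjective_endo_leq n (g : omap n n) : vertex_set g = setT -> forall i, g i <= i.
Proof.
move=> gT i; have [m lt_im] := ubnP (nat_of_ord i).
elim: m i lt_im => // m IH i; rewrite ltnS => lt_im; rewrite leqNgt; apply/negP => lt_i.
have : i \in vertex_set g by rewrite gT inE.
case/imsetP => l _ il; have li : l < i.
  by rewrite ltnNge; apply/negP => /(omap_leq g); rewrite -il leqNgt lt_i.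
by have := IH l (leq_trans li lt_im); rewrite -il leqNgt li.
Qed.

Lemma surjective_endo n (g : omap n n) : vertex_set g = setT -> g = oid n.
Proof.
move=> gT; apply: omapP => i; rewrite omkE; apply/ord_inj/eqP.
rewrite eqn_leq surjective_endo_leq //=.
have [d [gd _]] := section_through ord0 gT.
have d_inj : injective d by apply: can_inj gd.
have dT : vertex_set d = setT.
  by apply/eqP; rewrite eqEcard subsetT /= card_imset // cardsT.
by rewrite -{1}(gd i); apply: omap_leq; apply: surjective_endo_leq.
Qed.

Lemma missing_factor r n (t : omap r n.+1) : vertex_set t != setT ->
  exists (d : omap n n.+1) (t' : omap r n), t = ocomp d t'.
Proof.
rewrite -subTset => /subsetPn[j _ jt].
have d_mono (i i' : 'I_n.+1) : i <= i' -> lift j i <= lift j i' by rewrite /= leq_bump2.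
have tj l : t l != j by apply: contraNneq jt => <-; apply: mem_vertex_set.
have t'_lt l : unbump j (t l) < n.+1.
  move: (tj l) (ltn_ord (t l)) (ltn_ord j); rewrite -val_eqE /= /unbump; lia.
have t'_mono (l l' : 'I_r.+1) : l <= l' -> Ordinal (t'_lt l) <= Ordinal (t'_lt l').
  move=> /(omap_leq t) /=; rewrite /unbump; lia.
exists (omk d_mono), (omk t'_mono); apply: omapP => l; apply: ord_inj.
by rewrite ocompE !omkE /= unbumpKcond (negPf (tj l : nat_of_ord (t l) != j)).
Qed.

Section EilenbergZilber.
Variable L : sSet.

Definition skeletal c n (x : L n) : Prop :=
  exists j, j < c /\ exists (a : omap n j) (y : L j), x = act a y.

Lemma skeletal_act c m n (a : omap m n) (x : L n) : skeletal c x -> skeletal c (act a x).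
Proof.
by case=> j [jc [b [y ->]]]; exists j; split=> //; exists (ocomp b a), y; rewrite act_comp.
Qed.

Lemma skeletal_missing r n (a : omap r n) (y : L n) : vertex_set a != setT -> skeletal n (act a y).
Proof.
case: n a y => [|n] a y.
  case/negP; rewrite eqEsubset subsetT /=; apply/subsetP => i _; rewrite [i]ord1 -(ord1 (a ord0)).
  exact: mem_vertex_set.
case/missing_factor => d [t ->]; exists n; split=> //; exists t, (act d y).
by rewrite act_comp.
Qed.

(** The uniqueness part of the Eilenberg-Zilber lemma: for a section d of a, the
    operator a' d is surjective, for otherwise y would come from a lower dimension,
    and is therefore the identity; sections through every point determine a'. *)
Lemma unique_presentation r n (a a' : omap r n) (y y' : L n) :
  vertex_set a = setT -> vertex_set a' = setT -> ~ skeletal n y ->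
  act a y = act a' y' -> a = a' /\ y = y'.
Proof.
move=> aT a'T ny ay.
have key l : exists2 d : omap n r, d (a l) = l & ocomp a' d = oid n /\ ocomp a d = oid n.
  have [d [ad dl]] := section_through l aT; exists d => //.
  have adE : ocomp a d = oid n by apply: omapP => j; rewrite ocompE ad omkE.
  split=> //; apply: surjective_endo; apply/eqP; apply/negPn/negP => g; apply: ny.
  have -> : y = act (ocomp a' d) y' by rewrite act_comp -ay -act_comp adE act_id.
  exact: skeletal_missing.
split.
  apply: omapP => l; have [d dl [a'd _]] := key l.
  by rewrite -{2}dl -ocompE a'd omkE.
have [d _ [a'd ad]] := key ord0.
by rewrite -[y]act_id -ad act_comp ay -act_comp a'd act_id.
Qed.
End EilenbergZilber.

(** * Induction over the skeleta of L *)
Section SkeletalInduction.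
Variables (E B : scsSet) (f : scmap E B) (hf : outer_fibration f) (hB : infty_bicategory B).
Variables (K L : scsSet) (k : scmap K L) (hk : inclusion k).
Variables (alpha : scmap (cyl_dom k) E) (H : scmap (gray Delta1 L) B).
Hypothesis hsq : smap_eq (scmap_comp f alpha) (scmap_comp H (cyl_incl k)).
Variable edge : L 0 -> E 1.
Hypotheses (edge_cartesian : forall u, cartesian_edge f (edge u))
  (edge_old : forall v : K 0, edge (k 0 v) = alpha 1 (cyl_sub k 1 (cyl_edge v)))
  (edge_target : forall u, new_vertex k u -> target (edge u) = alpha 0 (cyl_end k 0 (cyl_vertex u)))
  (edge_over : forall u, new_vertex k u -> f 1 (edge u) = H 1 (cyl_edge u)).

Local Notation cyl := (sprod (Delta 1) L).

Lemma end_cell_subproof r : face 1 [:: 1] r (oconst r ord_max).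
Proof. by apply/forallP => i; rewrite omkE. Qed.

Definition end_cell r : sub (face 1 [:: 1]) r := exist _ (oconst r ord_max) (end_cell_subproof r).

Lemma end_cell_unique r (s : sub (face 1 [:: 1]) r) : s = end_cell r.
Proof.
case: s => s hs; apply: eq_exist; apply: omapP => i; rewrite omkE.
by apply: ord_inj; have /forallP/(_ i) := hs; rewrite inE => /eqP.
Qed.

Lemma end_cellE r (s : omap r 1) : (forall l, s l = ord_max) -> s = sval (end_cell r).
Proof. by move=> s1; apply: omapP => i; rewrite s1 omkE. Qed.

Definition known r (p : cyl r) : E r :=
  match pselect (exists x : K r, k r x = p.2) with
  | left ex => alpha r (cyl_sub k r (p.1, sval (cid ex)))
  | right _ => alpha r (cyl_end k r (end_cell r, p.2))
  end.

Definition cyl_start r (p : cyl r) : Prop :=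
  (exists x : K r, k r x = p.2) \/ (forall l, p.1 l = ord_max).

Lemma known_sub r (s : omap r 1) (x : K r) : known (s, k r x) = alpha r (cyl_sub k r (s, x)).
Proof.
rewrite /known; case: pselect => [ex|[]]; last by exists x.
by case: cid => x' /= /hk ->.
Qed.

Lemma known_end r (x : L r) : known (sval (end_cell r), x) = alpha r (cyl_end k r (end_cell r, x)).
Proof.
rewrite /known; case: pselect => //= ex; case: cid => x' /= <-.
congr (alpha r _); apply/esym.
exact: (@po_glue _ _ _ (gray_map (scmap_id End1) k)
  (gray_map end1_incl (scmap_id K)) r (end_cell r, x')).
Qed.

Lemma cyl_start_act : act_closed (X := cyl) cyl_start.
Proof.
move=> m r a [s x] [[x' xE]|s1]; [left|right].
  by exists (act a x'); rewrite smap_act xE.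
by move=> l /=; rewrite ocompE s1.
Qed.

Lemma known_natural : natural_on (X := cyl) cyl_start known.
Proof.
move=> m r a [s x] [[x' /= <-]|s1].
  by rewrite /= /prod_act /= -smap_act !known_sub -!smap_act.
rewrite [s](end_cellE s1).
have -> : act a ((sval (end_cell r), x) : cyl r) = (sval (end_cell m), act a x).
  by congr pair; apply: omapP => l; rewrite ocompE !omkE.
rewrite !known_end -!smap_act; congr (alpha m (cyl_end k m _)).
by rewrite /= /prod_act /= [sub_act _ _]end_cell_unique.
Qed.

Lemma known_over r (p : cyl r) : cyl_start p -> f r (known p) = H r p.
Proof.
case: p => s x [[x' /= <-]|s1].
  rewrite known_sub; have /= -> := hsq (cyl_sub k r (s, x')).
  by rewrite (po_desc_pi (cyl_incl_subproof k)).
rewrite [s](end_cellE s1) known_end; have /= -> := hsq (cyl_end k r (end_cell r, x)).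
by rewrite (po_desc_pi (cyl_incl_subproof k)).
Qed.

Definition cyl_skel c r (p : cyl r) : Prop := cyl_start p \/ skeletal c p.2.

Lemma cyl_skel_act c : act_closed (X := cyl) (@cyl_skel c).
Proof.
move=> m r a p [sp|kp]; first by left; apply: cyl_start_act.
by right; apply: skeletal_act.
Qed.

(** The edges over the vertices enter in the first step; they are recorded because
    all later steps need them to be cartesian. *)
Definition partial_lift c (W : forall r, cyl r -> E r) : Prop :=
  [/\ natural_on (X := cyl) (@cyl_skel c) W,
      forall r (p : cyl r), cyl_skel c p -> f r (W r p) = H r p,
      forall r (p : cyl r), cyl_start p -> W r p = known p &
      0 < c -> forall u, W 1 (cyl_edge u) = edge u].

Definition new_cell n (y : L n) : Prop := ~ (exists x : K n, k n x = y) /\ ~ skeletal n y.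

(** The last clause is about vertices; it is phrased through n = 0 so that vertices
    and simplices of positive dimension can be treated by the same step. *)
Definition fills n (W : forall r, cyl r -> E r) (y : L n)
    (z : forall r, sprod (Delta 1) (Delta n) r -> E r) : Prop :=
  [/\ forall m r (a : omap m r) p, z m (act a p) = act a (z r p),
      forall r s t, f r (z r (s, t)) = H r (s, act t y),
      forall r s t, prism_start (s, t) -> z r (s, t) = W r (s, act t y) &
      n = 0 -> forall (u : L 0) (t : omap 1 n), act t y = act (codeg ord0) u ->
        z 1 (oid 1, t) = edge u].

Lemma omap0_unique m (s t : omap m 0) : s = t.
Proof. by apply: omapP => i; rewrite [s i]ord1 [t i]ord1. Qed.

Lemma new_vertex_fill W (y : L 0) : partial_lift 0 W -> new_cell y -> exists z, fills W y z.
Proof.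
move=> [natW overW knownW _] [nK nS].
have ny : new_vertex k y by [].
exists (fun r p => act p.1 (edge y)); split.
- by move=> m r a p; rewrite -act_comp.
- move=> r s t /=; rewrite smap_act edge_over // -smap_act; congr (H r _).
  rewrite /= /prod_act /= Delta_idl -act_comp; congr (_, act _ y); exact: omap0_unique.
- move=> r s t st; have s1 : forall l, s l = ord_max.
    case: st => [//|]; case/negP; rewrite eqEsubset subsetT /=; apply/subsetP => i _.
    by rewrite [i]ord1 -(ord1 (t ord0)) mem_vertex_set.
  rewrite knownW; last by right.
  rewrite (end_cellE s1) known_end.
  have -> : sval (end_cell r) = ocomp (oconst 0 ord_max) (oconst r ord0).
    by apply: omapP => i; rewrite ocompE !omkE.
  rewrite act_comp [act (oconst 0 _) _](edge_target ny) -!smap_act.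
  congr (alpha r (cyl_end k r _)); rewrite /= /prod_act /= [sub_act _ _]end_cell_unique.
  congr (_, act _ y); exact: omap0_unique.
- move=> _ u t tu /=; rewrite act_id; congr edge.
  rewrite -[y]act_id -[u]act_id -(omap0_unique (ocomp t (oconst 0 ord0)) (oid 0)).
  rewrite act_comp tu -act_comp; congr act; exact: omap0_unique.
Qed.

(** The triangles (0,i), (1,i), (1,i+1) of the prisms have this shape: the second
    coordinate degenerates along its first edge, as the Gray product requires. *)
Lemma thin_cylinder (s : omap 2 1) (x : L 2) :
  s tri0 = ord0 -> s tri1 = ord_max -> degenerate_along (inord 0 : 'I_2) x ->
  @thin (gray Delta1 L) (s, x).
Proof.
move=> s0 s1 dx; have ds : degenerate (s : Delta 1 2).
  exists edge1, (oid 1 : Delta 1 1); rewrite /= Delta_idl; apply: omapP => i; apply: ord_inj.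
  rewrite codegE /unbump; case: i => -[|[|[|//]]] i3.
  - by rewrite (_ : Ordinal i3 = tri0) ?s0 //; apply: ord_inj.
  - by rewrite (_ : Ordinal i3 = tri1) ?s1 //; apply: ord_inj.
  have := omap_leq s (isT : tri1 <= tri2); rewrite s1 (_ : Ordinal i3 = tri2); last exact: ord_inj.
  by have := ltn_ord (s tri2) => /=; lia.
split; [by right | by apply: thin_degenerate; case: dx | by right].
Qed.

Lemma new_cell_fill n W (y : L n) : partial_lift n W -> new_cell y -> exists z, fills W y z.
Proof.
case: n y => [|n] y; first exact: new_vertex_fill.
move=> [natW overW knownW ccW] [nK nS].
have h_act m r (a : omap m r) (p : sprod (Delta 1) (Delta n.+1) r) :
    H m ((act a p).1, act (act a p).2 y) = act a (H r (p.1, act p.2 y)).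
  by rewrite -smap_act /= /prod_act /= act_comp.
pose h : smap (sprod (Delta 1) (Delta n.+1)) B :=
  @SMap (sprod (Delta 1) (Delta n.+1)) B (fun r p => H r (p.1, act p.2 y)) h_act.
pose w r (p : sprod (Delta 1) (Delta n.+1) r) := W r (p.1, act p.2 y).
have skel r (p : sprod (Delta 1) (Delta n.+1) r) :
    prism_start p -> cyl_skel n.+1 ((p.1, act p.2 y) : cyl r).
  by case=> [s1|tn]; [left; right|right; apply: skeletal_missing].
pose u := act (oconst 0 (ord_max : 'I_n.+2)) y.
have [||r p /skel/overW //|||z [natz oz zw]] := @prism_fill E B f hf hB n.+1 isT h w (edge u).
- move=> s t s0 s1 t01; apply: (scmap_thin H); apply: thin_cylinder => //.
  have -> : (inord 0 : 'I_2) = edge0 by apply: ord_inj; rewrite inordK.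
  have -> : act t y = act (codeg edge0) (act (ocomp t (oseg edge1)) y).
    rewrite -act_comp; congr act; apply: omapP => i; rewrite !ocompE.
    case: (eqVneq i tri0) => [->|i0].
      by rewrite t01; congr (t _); apply: ord_inj; rewrite osegE codegE.
    congr (t _); apply: ord_inj; rewrite osegE codegE /= /unbump.
    by case: i i0 => -[|[|[]]].
  exact: degenerate_along_codeg.
- move=> m r a p /skel sp; rewrite /w -natW //.
  by rewrite /= /prod_act /= act_comp.
- exact: edge_cartesian.
- rewrite /w -ccW //; congr (W 1 (_, _)); rewrite /= /u -act_comp; congr act.
  by apply: omapP => i; rewrite ocompE !omkE.
exists z; split=> //.
by move=> r s t /zw ->.
Qed.

(** A simplex outside the part already treated is a degeneration a of a new
   cell y of dimension n, for a unique pair (a, y). *)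
Definition presents n r (x : L r) (ay : omap r n * L n) : Prop :=
  [/\ new_cell ay.2, vertex_set ay.1 = setT & x = act ay.1 ay.2].

Lemma presents_unique n r (x : L r) ay ay' : @presents n r x ay -> presents x ay' -> ay = ay'.
Proof.
case: ay ay' => a y [a' y'] [[_ ny] /= aT ->] [_ /= a'T eq_x].
by have [-> ->] := @unique_presentation L r n a a' y y' aT a'T ny eq_x.
Qed.

Lemma presents_skel n r (s : omap r 1) (x : L r) ay :
  @presents n r x ay -> cyl_skel n (s, x) -> forall l, s l = ord_max.
Proof.
case: ay => a y [[nK nS] /= aT ->]; have [d [ad _]] := section_through ord0 aT.
have yE : y = act d (act a y).
  by rewrite -act_comp -[LHS]act_id; congr act; apply: omapP => j; rewrite ocompE ad omkE.
case=> [[[x' xE]|//]|sk].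
  by case: nK; exists (act d x'); rewrite smap_act xE /= -yE.
by case: nS; rewrite yE; apply: skeletal_act.
Qed.

Lemma cyl_skelS n r (s : omap r 1) (x : L r) : cyl_skel n.+1 (s, x) ->
  cyl_skel n (s, x) \/ exists ay, @presents n r x ay.
Proof.
case=> [st|[j [jn [a [y /= xE]]]]]; first by left; left.
have [lt_jn|ge_jn] := ltnP j n; first by left; right; exists j; split=> //; exists a, y.
have jE : j = n by apply/eqP; rewrite eqn_leq ge_jn -ltnS jn.
move: jE a y xE => {jn ge_jn} -> a y xE.
have [[x' x'E]|nK] := pselect (exists x' : K n, k n x' = y).
  by left; left; left; exists (act a x'); rewrite smap_act x'E /= xE.
have [sk|nS] := pselect (skeletal n y).
  by left; right; rewrite /= xE; apply: skeletal_act.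
have [aT|aT] := eqVneq (vertex_set a) setT; last first.
  by left; right; rewrite /= xE; apply: skeletal_missing.
by right; exists (a, y).
Qed.

Lemma partial_lift_step n W : partial_lift n W -> exists W', partial_lift n.+1 W' /\
  forall r (p : cyl r), cyl_skel n p -> W' r p = W r p.
Proof.
move=> gW; have [natW overW knownW ccW] := gW.
have /boolp.choice[Z ZP] (y : L n) : exists z, new_cell y -> fills W y z.
  have [ny|ny] := pselect (new_cell y); first by have [z] := new_cell_fill gW ny; exists z.
  by exists (fun r p => W r (p.1, act p.2 y)).
pose W' r (p : cyl r) : E r := match pselect (exists ay, @presents n r p.2 ay) with
  | left ex => Z (sval (cid ex)).2 r (p.1, (sval (cid ex)).1)
  | right _ => W r p end.
have W'Z r (s : omap r 1) (x : L r) ay : @presents n r x ay -> W' r (s, x) = Z ay.2 r (s, ay.1).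
  move=> pr; rewrite /W' /=; case: pselect => [ex|[]]; last by exists ay.
  by case: cid => ay' /= /(presents_unique pr) <-.
have W'W r (p : cyl r) : cyl_skel n p -> W' r p = W r p.
  case: p => s x sp; rewrite /W' /=; case: pselect => // ex; case: cid => ay /= pr.
  have s1 := presents_skel pr sp; have [ny aT ->] := pr.
  by have [_ _ -> //] := ZP _ ny; left.
have W'any r (s : omap r 1) (a : omap r n) y : new_cell y -> W' r (s, act a y) = Z y r (s, a).
  move=> ny; have [aT|aT] := eqVneq (vertex_set a) setT; first by rewrite (W'Z _ _ _ (a, y)).
  rewrite W'W; last by right; apply: skeletal_missing.
  by have [_ _ -> //] := ZP _ ny; right.
exists W'; split=> //; split.
- move=> m r a [s x] /cyl_skelS[sp|[[b y] [ny bT /= xE]]].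
    by rewrite !W'W ?natW //; apply: cyl_skel_act.
  rewrite xE /prod_act /= -act_comp !W'any //.
  by have [natZ _ _ _] := ZP _ ny; rewrite -natZ.
- move=> r [s x] /cyl_skelS[sp|[[b y] [ny bT /= ->]]]; first by rewrite W'W ?overW.
  by rewrite W'any //; have [_ -> _ _] := ZP _ ny.
- by move=> r p sp; rewrite W'W ?knownW //; left.
(* The edges over the vertices are fixed in the step n = 0 and kept afterwards. *)
move=> _ u; have [n0|n_gt0] := posnP n; last first.
  rewrite W'W ?ccW //; right; exists 0; split=> //; by exists (codeg ord0), u.
have [[v vu]|nu] := pselect (exists v : K 0, k 0 v = u).
  have eE : cyl_edge u = (oid 1, k 1 (act (codeg ord0) v)) by rewrite smap_act vu.
  have st : cyl_start (cyl_edge u : cyl 1) by left; exists (act (codeg ord0) v); rewrite eE.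
  by rewrite W'W ?knownW //; [rewrite eE known_sub -vu edge_old|left].
have [|sp|[[a y] [ny aT /= xE]]] := @cyl_skelS n 1 (oid 1) (act (codeg ord0) u).
- by right; exists 0; split=> //; exists (codeg ord0), u.
- case: sp => [[[x xE]|/(_ ord0)]|[j [jn _]]]; last by rewrite n0 in jn.
    case: nu; exists (act (oconst 0 ord0) x); rewrite smap_act xE /= -act_comp -[RHS]act_id.
    congr act; exact: omap0_unique.
  by rewrite omkE => /(congr1 val).
rewrite /cyl_edge xE W'any //; have [_ _ _ zc] := ZP _ ny; exact: (zc n0 u a (esym xE)).
Qed.

Lemma partial_lift0 : partial_lift 0 known.
Proof.
have eqA r (p : cyl r) : cyl_skel 0 p -> cyl_start p by case=> // -[j []].
by split=> // [m r a p /eqA|r p /eqA]; [apply: known_natural|apply: known_over].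
Qed.

Fixpoint stage n : {W | partial_lift n W} :=
  match n return {W | partial_lift n W} with
  | 0 => exist _ known partial_lift0
  | n.+1 => let W' := cid (partial_lift_step (svalP (stage n))) in exist _ (sval W') (svalP W').1
  end.

Lemma stage_stable n m r (p : cyl r) : n <= m -> cyl_skel n p ->
  sval (stage m) r p = sval (stage n) r p.
Proof.
move=> nm sp; rewrite -(subnK nm); elim: (m - n) => [//|d IH].
rewrite addSn -IH.
have /= -> := (svalP (cid (partial_lift_step (svalP (stage (d + n)))))).2 r p => //.
case: sp => [|[j [jn ay]]]; [by left|right; exists j; split=> //].
by rewrite (leq_trans jn) ?leq_addl.
Qed.

Lemma cylinder_lift : exists Ht : scmap (gray Delta1 L) E,
  is_lift (cyl_incl k) f alpha H Ht /\ forall u, Ht 1 (cyl_edge u) = edge u.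
Proof.
(* Stage r + 1 is the first to determine all simplices of dimension r. *)
pose w r (p : cyl r) := sval (stage r.+1) r p.
have full r c (p : cyl r) : r < c -> cyl_skel c p.
  by move=> rc; right; exists r; split=> //; exists (oid r), p.2; rewrite act_id.
have wE r c (p : cyl r) : r < c -> w r p = sval (stage c) r p.
  by move=> rc; rewrite /w -(@stage_stable r.+1 c) //; apply: full.
have w_act m r (a : omap m r) (p : gray Delta1 L r) : w m (act a p) = act a (w r p).
  rewrite (@wE m (m + r).+1) ?ltnS ?leq_addr // (@wE r (m + r).+1) ?ltnS ?leq_addl //.
  have [nat _ _ _] := svalP (stage (m + r).+1); apply: nat; apply: full.
  by rewrite ltnS leq_addl.
have w_over r (p : cyl r) : f r (w r p) = H r p.
  have [_ over _ _] := svalP (stage r.+1); apply: over; exact: full.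
have w_known r (p : cyl r) : cyl_start p -> w r p = known p.
  have [_ _ kn _] := svalP (stage r.+1); exact: kn.
pose g : smap (gray Delta1 L) E := @SMap (gray Delta1 L) E w w_act.
have g_thin (t : gray Delta1 L 2) : thin t -> thin (g 2 t).
  by move=> tt; apply/(thin_over hf); rewrite [f 2 _]w_over; apply: (scmap_thin H).
exists (ScMap g_thin); split; last first.
  by move=> u; have [_ _ _ cE] := svalP (stage 2); apply: cE.
split=> [r q|r p]; last exact: w_over.
have [[[s x] ->]|[[s x] ->]] := po_cases q; rewrite /= (po_desc_pi (cyl_incl_subproof k)) /=.
  rewrite [s]end_cell_unique.
  have -> : gray_map_fun end1_incl (scmap_id L) (end_cell r, x) = (sval (end_cell r), x) by [].
  rewrite w_known ?known_end //.
  by right=> l; rewrite omkE.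
by rewrite w_known ?known_sub //; left; exists x.
Qed.

End SkeletalInduction.

(** Over the vertices of K the edges are those given by alpha; over the new ones
    they are the prescribed lifts. *)
Lemma prescribed_lift (E B : scsSet) (f : scmap E B) (hf : outer_fibration f)
    (hB : infty_bicategory B) (K L : scsSet) (k : scmap K L) (hk : inclusion k)
    (alpha : scmap (cyl_dom k) E) (H : scmap (gray Delta1 L) B)
    (hsq : smap_eq (scmap_comp f alpha) (scmap_comp H (cyl_incl k)))
    (hcart : forall v : K 0, cartesian_edge f (alpha 1 (cyl_sub k 1 (cyl_edge v))))
    (c : {u : L 0 | new_vertex k u} -> E 1) :
  (forall u, cartesian_lift f alpha H (sval u) (c u)) ->
  exists Ht : scmap (gray Delta1 L) E,
    is_lift (cyl_incl k) f alpha H Ht /\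
    forall u : {u : L 0 | new_vertex k u}, Ht 1 (cyl_edge (sval u)) = c u.
Proof.
move=> hc.
pose edge (u : L 0) : E 1 := match pselect (exists v : K 0, k 0 v = u) with
  | left ex => alpha 1 (cyl_sub k 1 (cyl_edge (sval (cid ex))))
  | right nu => c (exist _ u nu) end.
have edge_new u (nu : new_vertex k u) : edge u = c (exist _ u nu).
  rewrite /edge; case: pselect => [ex|nu']; first by case: nu.
  by congr (c (exist _ u _)); apply: Prop_irrelevance.
have edge_old v : edge (k 0 v) = alpha 1 (cyl_sub k 1 (cyl_edge v)).
  rewrite /edge; case: pselect => [ex|[]]; last by exists v.
  by case: cid => v' /= /hk ->.
have edge_cart u : cartesian_edge f (edge u).
  have [[v <-]|nu] := pselect (exists v : K 0, k 0 v = u); first by rewrite edge_old.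
  by rewrite (edge_new u nu); case: (hc (exist _ u nu)).
have [||Ht [lift edgeE]] := cylinder_lift hf hB hk hsq edge_cart edge_old.
- by move=> u nu; rewrite (edge_new u nu); case: (hc (exist _ u nu)).
- by move=> u nu; rewrite (edge_new u nu); case: (hc (exist _ u nu)).
by exists Ht; split=> // -[u nu]; rewrite edgeE edge_new.
Qed.

Theorem proposition2p5p1
  (E B : scsSet) (f : scmap E B)
  (hE : infty_bicategory E) (hB : infty_bicategory B) (hf : outer_fibration f)
  (K L : scsSet) (k : scmap K L) (hk : inclusion k)
  (alpha : scmap (cyl_dom k) E) (H : scmap (gray Delta1 L) B)
  (hsq : smap_eq (scmap_comp f alpha) (scmap_comp H (cyl_incl k)))
  (hcart : forall v : K 0, cartesian_edge f (alpha 1 (cyl_sub k 1 (cyl_edge v))))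
  (hlift : forall u : L 0, new_vertex k u -> exists e : E 1, cartesian_lift f alpha H u e) :
  (exists Ht : scmap (gray Delta1 L) E, is_lift (cyl_incl k) f alpha H Ht) /\
  (forall c : {u : L 0 | new_vertex k u} -> E 1,
     (forall u, cartesian_lift f alpha H (sval u) (c u)) ->
     exists Ht : scmap (gray Delta1 L) E,
       is_lift (cyl_incl k) f alpha H Ht /\
       forall u : {u : L 0 | new_vertex k u}, Ht 1 (cyl_edge (sval u)) = c u).
Proof.
have lift := prescribed_lift hf hB hk hsq hcart; split=> //.
have /boolp.choice[c cP] (u : {u : L 0 | new_vertex k u}) :
    exists e, cartesian_lift f alpha H (sval u) e by apply: hlift (svalP u).
by have [Ht [hHt _]] := lift c cP; exists Ht.
Qed.
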